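(* Let $G=(V,E)$ be an infinite, connected, locally finite, quasi-transitive graph of subexponential growth, with a fixed origin $o\in V$. Consider Bernoulli bond percolation on $G$ with parameter $p\in(0,1)$, and let $K_r$ be the number of connected components of the restricted open subgraph $G(\omega;B_r)$ of the ball $B_r$ of radius $r$ centered at $o$. Then, as $r\to\infty$, $$\frac{K_r-\mathbb{E}_p[K_r]}{\sqrt{\operatorname{Var}_p(K_r)}}\ \Longrightarrow\ \mathcal{N}(0,1)$$ in distribution.
   Context: An automorphism of $G$ is an adjacency-preserving bijection $V\to V$; $G$ is quasi-transitive if the action of $\operatorname{Aut}(G)$ on $V$ has finitely many orbits. Let $d_G$ be the graph distance and $B_r(v)=\{w\in V: d_G(v,w)\le r\}$, $B_r=B_r(o)$. $G$ has subexponential growth if $\lim_{r\to\infty}\frac1r\log|B_r(v)|=0$ for all $v\in V$. Bernoulli bond percolation with parameter $p$: $\Omega=\{0,1\}^E$ with the product measure $\mathbb{P}_p$ under which the coordinates $\omega(e)$, $e\in E$, are independent with $\mathbb{P}_p(\omega(e)=1)=p$; $\mathbb{E}_p,\operatorname{Var}_p$ denote the corresponding expectation and variance. An edge $e$ is open if $\omega(e)=1$. For $A\subseteq V$, $G(\omega;A)$ is the random graph with vertex set $A$ and edge set $\{\{x,y\}\in E: x,y\in A,\ \omega(\{x,y\})=1\}$. *)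

(* Defs.v *)
From HB Require Import structures.
From mathcomp Require Import all_boot all_order all_algebra finmap.
From mathcomp Require Import all_classical all_reals all_analysis.
From mathcomp Require Import measurable_realfun.

Set Implicit Arguments.
Unset Strict Implicit.
Unset Printing Implicit Defensive.

Import Order.TTheory GRing.Theory Num.Theory.
Import numFieldNormedType.Exports.

Local Open Scope classical_set_scope.
Local Open Scope ring_scope.

Section graph.
Variables (V : choiceType) (adj : rel V).

Definition simple_graph := symmetric adj /\ irreflexive adj.

Definition walk (v w : V) (n : nat) :=
  exists s : seq V, [/\ path adj v s, last v s = w & size s = n].

Definition connected_graph := forall v w, exists n, walk v w n.

Definition locally_finite := forall v, finite_set [set w | adj v w].

Definition automorphism (f : V -> V) :=
  bijective f /\ forall x y, adj (f x) (f y) = adj x y.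

Definition aut_orbit (v : V) : set V :=
  [set w | exists2 f, automorphism f & f v = w].

Definition quasi_transitive := finite_set (range aut_orbit).

(* The value 0 for vertices not joined by a walk is a dummy: distances are only
   used in connected graphs. *)
Definition gdist (v w : V) : nat :=
  if pselect (exists n, `[< walk v w n >]) is left h then ex_minn h else 0%N.

Definition gball (v : V) (r : nat) : set V := [set w | (gdist v w <= r)%N].

(* [fset_set] of a finite set is its enumeration; balls are finite in connected
   locally finite graphs. *)
Definition subexponential_growth (R : realType) :=
  forall v, (r%:R^-1 * ln (#|` fset_set (gball v r)|%:R : R))
              @[r --> \oo] --> (0 : R).

Definition edge :=
  {e : {fset V} | `[< exists x y, adj x y /\ e = [fset x; y]%fset >]}.

Definition cylinder : set (set (edge -> bool)) :=
  [set A | exists e B, A = [set w | B (w e)]].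

(* {0,1}^E with the product sigma-algebra *)
Definition config := g_sigma_algebraType cylinder.

(* [insub] is None when {x, y} is not an edge of the graph. *)
Definition is_open (w : config) (x y : V) : bool :=
  oapp w false (insub [fset x; y]%fset).

Definition open_subgraph (w : config) (A : {fset V}) : rel A :=
  [rel x y | is_open w (val x) (val y)].

Definition ncomponents (w : config) (A : {fset V}) : nat :=
  n_comp (open_subgraph w (A := A)) predT.

End graph.

Section percolation.
Variables (V : choiceType) (adj : rel V) (R : realType).
Variable P : probability (config adj) R.

Definition independent_coordinates :=
  forall (F : {fset edge adj}) (B : edge adj -> set bool),
    P (\bigcap_(e in [set` F]) [set w | B e (w e)]) =
    (\prod_(e <- F) P [set w | B e (w e)])%E.

(* P is the product measure: by the pi-lambda theorem these two conditions
   determine P on the sigma-algebra generated by the cylinders. *)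
Definition bernoulli_percolation (p : R) :=
  independent_coordinates /\ forall e, P [set w | w e = true] = p%:E.

Definition Kcomp (o : V) (r : nat) (w : config adj) : R :=
  (ncomponents w (fset_set (gball adj o r)))%:R.

Lemma measurable_coord (e : edge adj) (B : set bool) :
  measurable ([set w | B (w e)] : set (config adj)).
Proof. by apply: sub_sigma_algebra; exists e, B. Qed.

Lemma measurable_is_open x y b :
  measurable ([set w | is_open w x y = b] : set (config adj)).
Proof.
rewrite /is_open; case: insubP => [e _ _|_] /=.
  exact: (measurable_coord e [set b]).
case: b.
  by rewrite (_ : [set _ | _] = set0) //; apply/seteqP; split.
by rewrite (_ : [set _ | _] = setT) //; apply/seteqP; split.
Qed.

Lemma measurable_Kcomp o r : measurable_fun setT (Kcomp o r).
Proof.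
move=> _ Y mY; rewrite setTI /Kcomp.
set A := fset_set _.
pose enc (w : config adj) : {ffun A * A -> bool} :=
  [ffun xy => is_open w (val xy.1) (val xy.2)].
pose nc (g : {ffun A * A -> bool}) := n_comp [rel x y | g (x, y)] predT.
have Kenc w : ncomponents w A = nc (enc w).
  rewrite /ncomponents /nc; apply: eq_n_comp; apply: eq_connect => x y.
  by rewrite /= ffunE.
rewrite (_ : _ @^-1` Y =
    \bigcup_(g in [set g | Y (nc g)%:R])
      \bigcap_(xy in [set: A * A]) [set w | is_open w (val xy.1) (val xy.2) = g xy]).
  apply: fin_bigcup_measurable => [|g _]; first exact: finite_finset.
  apply: fin_bigcap_measurable => [|xy _]; first exact: finite_finset.
  exact: measurable_is_open.
apply/seteqP; split => [w /= Yw|w [g /= Yg gw]].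
  exists (enc w); first by rewrite /= -Kenc.
  by move=> xy _ /=; rewrite ffunE.
rewrite Kenc (_ : enc w = g) //.
by apply/ffunP => xy; rewrite ffunE; exact: gw.
Qed.

HB.instance Definition _ o r :=
  isMeasurableFun.Build _ _ _ _ (Kcomp o r) (@measurable_Kcomp o r).

Definition standardized d (T : measurableType d) (Q : probability T R)
    (X : T -> R) : T -> R :=
  fun w => (X w - fine 'E_Q[X]) / Num.sqrt (fine 'V_Q[X]).

Lemma measurable_standardized d (T : measurableType d) (Q : probability T R)
  (X : {RV Q >-> R}) : measurable_fun setT (standardized Q X).
Proof.
apply: measurable_funM; last exact: measurable_cst.
by apply: measurable_funB; [exact: measurable_funPT|exact: measurable_cst].
Qed.

HB.instance Definition _ d (T : measurableType d) (Q : probability T R)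
  (X : {RV Q >-> R}) :=
  isMeasurableFun.Build _ _ _ _ (standardized Q X) (measurable_standardized X).

(* Convergence of the distribution functions at every continuity point of the
   limiting one. *)
Definition cvg_in_distribution d (T : measurableType d) (Q : probability T R)
    (X : nat -> {RV Q >-> R}) (mu : probability (measurableTypeR R) R) :=
  forall x : R, {for x, continuous (fun y : R => mu `]-oo, y]%classic)} ->
    cdf (X n) x @[n --> \oo] --> mu `]-oo, x]%classic.

End percolation.

(* Main.v *)
Require Import Defs.
From HB Require Import structures.
From mathcomp Require Import all_boot all_order all_algebra finmap.
From mathcomp Require Import all_classical all_reals all_analysis.
From mathcomp Require Import measurable_realfun.
From mathcomp Require Import ring lra.

(** The number [K] of open clusters of a finite graph is the sum over its
    vertices [v] of [1 / |C_v|], where [C_v] is the open cluster of [v].  The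
    theorem holds because [K] is, up to an error that is negligible on the scale
    of its standard deviation, a sum of bounded functions of bounded
    neighbourhoods, and because the variance of [K] is at least proportional to
    the number of edges.  All estimates are uniform over finite graphs of bounded
    degree, so that the boundary of the ball needs no separate treatment; the
    degrees of a quasi-transitive locally finite graph are bounded.

    Everything rests on one identity on the cube [{0,1}^I]
    ([covariance_dif]): with [D_i f] the difference of the values of [f] when
    edge [i] is open and closed, and [M_i] the average over the edges after [i],
    [Cov(f, g) = p (1 - p) * sum_i E(M_i (D_i f) * D_i g)].  It yields the
    Efron-Stein upper bound [p (1 - p) * sum_i E((D_i f)^2)] and the lower bound
    [p (1 - p) * sum_i (E(D_i f))^2] for the variance.  The lower bound applied
    to [K] is of the order of the number of edges, since opening an edge absorbs
    an isolated vertex with probability bounded below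
    ([Var_cluster_sum_ge]).

    Fix a large constant [n] and split [1/s = max(1/s - 1/n, 0) + min(1/s, 1/n)].
    The second part gives a sum [N] over the vertices whose variance is at most a
    small multiple of the number of vertices ([Var_cluster_sum_le]).  Each edge
    decreases [N] by at most 2, so by Efron-Stein it suffices to bound
    [- sum_i E(D_i N)].  Edge [i] only affects the vertices whose cluster it
    touches, and this makes [- p (1 - p) * sum_i E(D_i N)] equal to
    [E(sum_v k_v Z_v)], where [k_v] is the summand of [v] in [N] and [Z_v] is the
    sum of the centred variables [p - w_i] over the edges [i] touching [C_v].
    Now [lam Z_v] is at most [2 lam^2] times the number of these edges plus the
    product of [1 + lam (p - w_i)] over them, and this product has mean one
    ([Ex_cluster_prod]).  As [k_v] is also at most [1 / |C_v|], the mean of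
    [k_v Z_v] is at most [2 lam D + 1 / (lam n)], where [D] bounds the degrees;
    take [lam] small, then [n] large.

    The first part gives a function [f] with bounded differences and such that
    [D_j (D_i f)] vanishes unless [i] and [j] are close ([card_interacting]).
    Applying the covariance identity to [f] and [phi(f)], for a function [phi]
    solving Stein's equation [phi' - x phi = h - E h(Z)], reduces the central
    limit theorem to the concentration of
    [p (1 - p) * sum_i M_i (D_i f) * D_i f], which follows from Efron-Stein again
    ([stein_bound]).  As [N] is negligible the standardized versions of [K] and
    [f] are close in mean square ([standardize_close]), and a piecewise linear
    test function [h] squeezed between indicators of half-lines gives the
    convergence of the distribution functions. *)

Set Implicit Arguments.
Unset Strict Implicit.
Unset Printing Implicit Defensive.

Import Order.TTheory GRing.Theory Num.Theory.
Import numFieldNormedType.Exports.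

Local Open Scope ring_scope.

(** * Functions of finitely many independent bits *)

Section Cube.
Variables (R : realType) (I : finType) (p : R).

Local Notation cube := {ffun I -> bool}.

Implicit Types (f g u : cube -> R) (w : cube) (i j : I) (s : seq I).

Definition coin (b : bool) : R := if b then p else 1 - p.

Definition weight w : R := \prod_i coin (w i).

Definition Ex f : R := \sum_w weight w * f w.

Definition upd w i b : cube := [ffun j => if j == i then b else w j].

Definition dif i f w : R := f (upd w i true) - f (upd w i false).

Definition avg i f w : R := p * f (upd w i true) + (1 - p) * f (upd w i false).

Definition avgs s f : cube -> R := foldr avg f s.

Lemma upd_at w i b : upd w i b i = b.
Proof. by rewrite ffunE eqxx. Qed.

Lemma upd_ne w i b j : j != i -> upd w i b j = w j.
Proof. by rewrite ffunE => /negbTE ->. Qed.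

Lemma upd_id w i : upd w i (w i) = w.
Proof. by apply/ffunP => j; rewrite ffunE; case: eqP => [->|]. Qed.

Lemma upd_upd w i b c : upd (upd w i b) i c = upd w i c.
Proof. by apply/ffunP => j; rewrite !ffunE; case: eqP. Qed.

Lemma updC w i j b c : i != j -> upd (upd w i b) j c = upd (upd w j c) i b.
Proof.
move=> ij; apply/ffunP => k; rewrite !ffunE.
by case: (eqVneq k j) => // ->; rewrite eq_sym (negbTE ij).
Qed.

Lemma eq_Ex f g : f =1 g -> Ex f = Ex g.
Proof. by move=> fg; apply: eq_bigr => w _; rewrite fg. Qed.

Lemma ExD f g : Ex (fun w => f w + g w) = Ex f + Ex g.
Proof. by rewrite -big_split; apply: eq_bigr => w _; rewrite mulrDr. Qed.

Lemma ExZ c f : Ex (fun w => c * f w) = c * Ex f.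
Proof. by rewrite big_distrr; apply: eq_bigr => w _; rewrite mulrCA. Qed.

Lemma ExN f : Ex (fun w => - f w) = - Ex f.
Proof. by rewrite -mulN1r -ExZ; apply: eq_Ex => w; rewrite mulN1r. Qed.

Lemma ExB f g : Ex (fun w => f w - g w) = Ex f - Ex g.
Proof. by rewrite ExD ExN. Qed.

Lemma Ex_sum (J : Type) (r : seq J) (P : pred J) (F : J -> cube -> R) :
  Ex (fun w => \sum_(k <- r | P k) F k w) = \sum_(k <- r | P k) Ex (F k).
Proof.
rewrite /Ex exchange_big /=; apply: eq_bigr => w _.
by rewrite big_distrr.
Qed.

Lemma Ex_prod (q : I -> bool -> R) :
  Ex (fun w => \prod_i q i (w i)) =
  \prod_i (p * q i true + (1 - p) * q i false).
Proof.
rewrite /Ex /weight /=; under eq_bigr do rewrite -big_split /=.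
rewrite -(bigA_distr_bigA (fun i b => coin b * q i b)).
by apply: eq_bigr => i _; rewrite big_bool.
Qed.

Lemma Ex_cst c : Ex (fun=> c) = c.
Proof.
have Ex1 : Ex (fun=> 1) = 1.
  rewrite (@eq_Ex _ (fun w => \prod_(i : I) 1)); last first.
    by move=> w; rewrite big1.
  rewrite (Ex_prod (fun _ _ => 1)) big1 // => i _; ring.
by rewrite -[RHS]mulr1 -Ex1 -ExZ; apply: eq_Ex => w; rewrite mulr1.
Qed.

Lemma eq_avg i f g : f =1 g -> avg i f =1 avg i g.
Proof. by move=> fg w; rewrite /avg !fg. Qed.

Lemma eq_dif i f g : f =1 g -> dif i f =1 dif i g.
Proof. by move=> fg w; rewrite /dif !fg. Qed.

Lemma eq_avgs s f g : f =1 g -> avgs s f =1 avgs s g.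
Proof. by move=> fg; elim: s => //= i s IH; exact: eq_avg. Qed.

Lemma Ex_avg i f : Ex (avg i f) = Ex f.
Proof.
(* Pair each configuration with the one whose bit [i] is flipped. *)
pose fl w := upd w i (~~ w i).
have flK : involutive fl.
  by move=> w; rewrite /fl upd_at negbK upd_upd upd_id.
have pair (F : cube -> R) : \sum_w F w = \sum_(w : cube | w i) (F w + F (fl w)).
  rewrite (bigID (fun w => w i)) big_split /=; congr (_ + _).
  rewrite (reindex_inj (can_inj flK)) /=; apply: eq_bigl => w.
  by rewrite /fl upd_at negbK.
rewrite /Ex !pair; apply: eq_bigr => w wi.
have we : weight w = p * \prod_(j | j != i) coin (w j).
  by rewrite /weight (bigD1 i) //= wi.
have wf : weight (fl w) = (1 - p) * \prod_(j | j != i) coin (w j).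
  rewrite /weight (bigD1 i) //= {1}/fl upd_at wi /=; congr (_ * _).
  by apply: eq_bigr => j ji; rewrite /fl upd_ne.
rewrite we wf /avg /fl !upd_upd wi /=.
have -> : upd w i true = w by rewrite -[in RHS](upd_id w i) wi.
ring.
Qed.

Lemma Ex_avgs s f : Ex (avgs s f) = Ex f.
Proof. by elim: s => //= i s IH; rewrite Ex_avg. Qed.

(** The coordinates of [w] can be replaced by those of [w'] one at a time. *)
Lemma dif0_const f : (forall i w, dif i f w = 0) -> forall w w', f w = f w'.
Proof.
move=> f0 w w'.
pose mix s := foldr (fun i v => upd v i (w' i)) w s.
have mixE s : f (mix s) = f w.
  elim: s => //= i s <-; have /eqP := f0 i (mix s).
  rewrite subr_eq0 => /eqP e.
  rewrite -[in RHS](upd_id (mix s) i).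
  by case: (w' i); case: (mix s i); rewrite ?e.
have mixin s i : i \in s -> mix s i = w' i.
  elim: s => //= j s IH; rewrite inE.
  by case: (eqVneq i j) => [->|ij /= /IH]; rewrite ?upd_at ?upd_ne.
rewrite -(mixE (enum I)); congr f; apply/ffunP => i.
by rewrite mixin ?mem_enum.
Qed.

Lemma dif_avg_same i f w : dif i (avg i f) w = 0.
Proof. by rewrite /dif /avg !upd_upd subrr. Qed.

Lemma dif_avg i j f w : i != j -> dif i (avg j f) w = avg j (dif i f) w.
Proof. by move=> ij; rewrite /dif /avg !(updC _ _ _ ij); ring. Qed.

Lemma avg0 i w : avg i (fun=> 0) w = 0.
Proof. by rewrite /avg !mulr0 addr0. Qed.

Lemma dif_avgs_notin s i f : i \notin s -> dif i (avgs s f) =1 avgs s (dif i f).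
Proof.
elim: s => //= j s IH; rewrite inE negb_or => /andP[ij /IH e] w.
by rewrite dif_avg //; exact: eq_avg.
Qed.

Lemma dif_avgs_in s i f w : i \in s -> dif i (avgs s f) w = 0.
Proof.
elim: s w => //= j s IH w; rewrite inE.
case: (eqVneq i j) => [->|ij /= si]; first by rewrite dif_avg_same.
by rewrite dif_avg // -[RHS](avg0 j w); apply: eq_avg => v; exact: IH.
Qed.

Lemma avg_mul i f g : (forall w, dif i f w = 0) ->
  avg i (fun w => f w * g w) =1 (fun w => f w * avg i g w).
Proof.
move=> f0 w; have /eqP := f0 w; rewrite subr_eq0 => /eqP e.
have f1 : f (upd w i true) = f w.
  by rewrite -[in RHS](upd_id w i); case: (w i).
by rewrite /avg -e f1; ring.
Qed.

Lemma avgs_mul s f g : (forall i w, i \in s -> dif i f w = 0) ->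
  avgs s (fun w => f w * g w) =1 (fun w => f w * avgs s g w).
Proof.
elim: s => //= i s IH f0 w.
rewrite (@eq_avg i _ (fun w => f w * avgs s g w)); last first.
  by apply: IH => j v js; apply: f0; rewrite inE js orbT.
by rewrite avg_mul // => v; apply: f0; rewrite mem_head.
Qed.

Definition later i : seq I := drop (index i (enum I)).+1 (enum I).

(** No coordinate matters any more after averaging over all of them, and
    averaging preserves the mean. *)
Lemma avgs_enum f w : avgs (enum I) f w = Ex f.
Proof.
have c : forall v, avgs (enum I) f v = avgs (enum I) f w.
  by move=> v; apply: dif0_const => i x; rewrite dif_avgs_in ?mem_enum.
by rewrite -(Ex_avgs (enum I)) (eq_Ex c) Ex_cst.
Qed.

Lemma Ex_mul_dif i f g :
  Ex (fun w => f w * g w) - Ex (fun w => avg i f w * g w) =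
  p * (1 - p) * Ex (fun w => dif i f w * dif i g w).
Proof.
rewrite -ExB -(Ex_avg i) -ExZ; apply: eq_Ex => w.
by rewrite /avg /dif !upd_upd; ring.
Qed.

(** Telescoping: replacing [f] by its average over one more coordinate changes
    its covariance with [g] by a quantity that only involves the discrete
    derivatives in that coordinate. *)
Lemma covariance_dif f g :
  Ex (fun w => f w * g w) - Ex f * Ex g =
  p * (1 - p) *
    \sum_i Ex (fun w => avgs (later i) (dif i f) w * dif i g w).
Proof.
suff tel s : uniq s -> Ex (fun w => f w * g w) - Ex (fun w => avgs s f w * g w) =
    p * (1 - p) * \sum_(i <- s)
      Ex (fun w => avgs (drop (index i s).+1 s) (dif i f) w * dif i g w).
  rewrite -ExZ -big_enum -(tel _ (enum_uniq I)); congr (_ - _).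
  by apply: eq_Ex => w; rewrite avgs_enum.
elim: s => [|i s IH] /=; first by rewrite big_nil mulr0 subrr.
move=> /andP[si us]; rewrite big_cons eqxx drop0 mulrDr.
rewrite [X in _ = _ + _ * X](_ : _ = \sum_(j <- s)
   Ex (fun w => avgs (drop (index j s).+1 s) (dif j f) w * dif j g w)); last first.
  rewrite !big_seq; apply: eq_bigr => j js; rewrite ifF //.
  by apply/negP => /eqP ij; rewrite ij js in si.
rewrite -IH // (@eq_Ex (fun w => avgs s (dif i f) w * _)
                       (fun w => dif i (avgs s f) w * dif i g w)).
  by rewrite -Ex_mul_dif /=; ring.
by move=> w; rewrite dif_avgs_notin.
Qed.

Lemma Ex_avgs_mul s u (v : cube -> R) :
  Ex (fun w => avgs s u w * v w) = Ex (fun w => avgs s u w * avgs s v w).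
Proof.
rewrite -(Ex_avgs s); apply: eq_Ex => w; apply: avgs_mul => i x si.
exact: dif_avgs_in.
Qed.

Hypothesis p01 : 0 < p < 1.

Let p0 : 0 < p. Proof. by case/andP: p01. Qed.
Let q0 : 0 < 1 - p. Proof. by rewrite subr_gt0; case/andP: p01. Qed.

Let pq_ge0 : 0 <= p * (1 - p). Proof. by apply: ltW; exact: mulr_gt0. Qed.

Lemma weight_ge0 w : 0 <= weight w.
Proof. by apply: prodr_ge0 => i _; rewrite /coin; case: ifP => _; exact: ltW. Qed.

Lemma le_Ex f g : (forall w, f w <= g w) -> Ex f <= Ex g.
Proof. by move=> fg; apply: ler_sum => w _; rewrite ler_wpM2l ?weight_ge0. Qed.

Lemma Ex_ge0 f : (forall w, 0 <= f w) -> 0 <= Ex f.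
Proof. by move=> f0; apply: sumr_ge0 => w _; rewrite mulr_ge0 ?weight_ge0. Qed.

Lemma ler_norm_Ex f : `|Ex f| <= Ex (fun w => `|f w|).
Proof.
apply: le_trans (ler_norm_sum _ _ _) _; apply: ler_sum => w _.
by rewrite normrM ger0_norm ?weight_ge0.
Qed.

Lemma norm_avgs_le s u b : (forall w, `|u w| <= b) -> forall w, `|avgs s u w| <= b.
Proof.
move=> ub; elim: s => //= i s IH w; rewrite /avg.
have := IH (upd w i true); have := IH (upd w i false); rewrite !ler_norml.
move: p0 q0 => p_gt0 q_gt0 /andP[? ?] /andP[? ?]; apply/andP; split; nra.
Qed.

Definition Var f : R := Ex (fun w => (f w - Ex f) ^+ 2).

Lemma Var_ge0 f : 0 <= Var f.
Proof. by apply: Ex_ge0 => w; exact: sqr_ge0. Qed.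

Lemma VarE f : Var f = Ex (fun w => f w * f w) - Ex f * Ex f.
Proof.
rewrite /Var (@eq_Ex _ (fun w => f w * f w + ((- 2 * Ex f) * f w + Ex f ^+ 2))).
  by rewrite !ExD ExZ Ex_cst; ring.
by move=> w; ring.
Qed.

Lemma sqr_Ex_le f : Ex f ^+ 2 <= Ex (fun w => f w ^+ 2).
Proof.
have := Var_ge0 f; rewrite VarE subr_ge0 -expr2 => /le_trans; apply.
by apply: le_Ex => w; rewrite expr2.
Qed.

Lemma sqr_avgs_le s u w : avgs s u w ^+ 2 <= avgs s (fun w => u w ^+ 2) w.
Proof.
elim: s w => //= i s IH w; rewrite /avg.
have := IH (upd w i true); have := IH (upd w i false).
set a := avgs s u _; set b := avgs s u _ => h1 h2.
rewrite (le_trans _ (lerD (ler_wpM2l (ltW p0) h2) (ler_wpM2l (ltW q0) h1))) //.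
rewrite -subr_ge0.
rewrite (_ : _ - _ = p * (1 - p) * (a - b) ^+ 2); last by ring.
by rewrite mulr_ge0 ?sqr_ge0// mulr_ge0 ?ltW.
Qed.

(** In the covariance identity for [f] with itself each term is the second moment
    of an average of [dif i f], and averaging contracts second moments. *)
Lemma Efron_Stein f :
  Var f <= p * (1 - p) * \sum_i Ex (fun w => dif i f w ^+ 2).
Proof.
rewrite VarE covariance_dif ler_wpM2l ?pq_ge0//.
apply: ler_sum => i _; rewrite Ex_avgs_mul -(Ex_avgs (later i) (fun w => _ ^+ 2)).
by apply: le_Ex => w; rewrite -expr2; exact: sqr_avgs_le.
Qed.

(** The second moments in the covariance identity dominate the squared means,
    which averaging leaves unchanged. *)
Lemma Var_ge_dif f : p * (1 - p) * \sum_i Ex (dif i f) ^+ 2 <= Var f.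
Proof.
rewrite VarE covariance_dif ler_wpM2l ?pq_ge0//.
apply: ler_sum => i _; rewrite Ex_avgs_mul -(Ex_avgs (later i) (dif i f)).
by apply: le_trans (sqr_Ex_le _) _; apply: le_Ex => w; rewrite expr2.
Qed.

End Cube.

(** * Normal approximation on the cube *)

Section SecondOrder.
Variables (R : realType) (I : finType) (p : R).
Hypothesis p01 : 0 < p < 1.

Local Notation cube := {ffun I -> bool}.
Local Notation Ex := (Ex p).
Local Notation Var := (Var p).
Local Notation avgs := (avgs p).

Let pq_ge0 : 0 <= p * (1 - p).
Proof. by case/andP: p01 => ? ?; rewrite mulr_ge0 ?subr_ge0 ?ltW. Qed.

Let pq_le1 : p * (1 - p) <= 1.
Proof. by case/andP: p01 => ? ?; nra. Qed.

Definition interacting (F : cube -> R) (j : I) : {set I} :=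
  [set i | [exists w, dif j (dif i F) w != 0]].

(** Integration by parts turns [Ex (F * phi F)] into approximately
    [Ex (phi' F * stein_kernel F)] for a centred [F]; the mean of the kernel is
    the variance of [F]. *)
Definition stein_kernel (F : cube -> R) (w : cube) : R :=
  p * (1 - p) * \sum_i avgs (later i) (dif i F) w * dif i F w.

Variables (F : cube -> R) (b : R) (M : nat).
Hypothesis dif_le : forall i w, `|dif i F w| <= b.
Hypothesis inter_le : forall j, (#|interacting F j| <= M)%N.
Hypothesis b0 : 0 <= b.

Let avgs_dif_le i s w : `|avgs s (dif i F) w| <= b.
Proof. exact: norm_avgs_le. Qed.

Let summand_le i w : `|avgs (later i) (dif i F) w * dif i F w| <= b ^+ 2.
Proof. by rewrite normrM expr2 ler_pM. Qed.

Let summand_dif0 i j w : i \notin interacting F j ->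
  dif j (fun w => avgs (later i) (dif i F) w * dif i F w) w = 0.
Proof.
rewrite inE negb_exists => /forallP h.
have e0 v : dif j (dif i F) v = 0 by apply/eqP; have := h v; rewrite negbK.
have e1 v : dif j (avgs (later i) (dif i F)) v = 0.
  have [js|js] := boolP (j \in later i); first exact: dif_avgs_in.
  rewrite dif_avgs_notin // (eq_avgs _ _ e0).
  by elim: (later i) v => //= k s IH v; rewrite (eq_avg _ _ IH) avg0.
have /eqP := e0 w; have /eqP := e1 w; rewrite /dif !subr_eq0 => /eqP -> /eqP.
by rewrite /dif => ->; rewrite subrr.
Qed.

(** A coordinate moves the kernel only through the few coordinates that interact
    with it, so that Efron-Stein shows that the kernel concentrates. *)
Lemma Var_stein_kernel :
  Var (stein_kernel F) <= 4 * #|I|%:R * M%:R ^+ 2 * b ^+ 4.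
Proof.
apply: le_trans (Efron_Stein p01 _) _.
have difK j w : `|dif j (stein_kernel F) w| <= M%:R * (2 * b ^+ 2).
  have -> : dif j (stein_kernel F) w = p * (1 - p) *
      \sum_i dif j (fun w => avgs (later i) (dif i F) w * dif i F w) w.
    by rewrite /dif /stein_kernel -mulrBr -sumrB.
  rewrite normrM (ger0_norm pq_ge0).
  apply: le_trans (_ : 1 * _ <= _); first exact: ler_wpM2r.
  rewrite mul1r (bigID (mem (interacting F j))) /= [X in _ + X]big1 ?addr0; last first.
    by move=> i; exact: summand_dif0.
  apply: le_trans (ler_norm_sum _ _ _) _.
  apply: le_trans (_ : \sum_(i in interacting F j) 2 * b ^+ 2 <= _).
    apply: ler_sum => i _; rewrite mulr2n mulrDl mul1r.
    by apply: le_trans (ler_normB _ _) _; apply: lerD; exact: summand_le.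
  rewrite sumr_const -[leLHS]mulr_natl ler_wpM2r ?ler_nat //.
  by rewrite mulr_ge0 ?sqr_ge0.
apply: le_trans (_ : 1 * _ <= _).
  apply: ler_wpM2r => //; apply: sumr_ge0 => i _; apply: Ex_ge0 => // w.
  exact: sqr_ge0.
rewrite mul1r.
apply: le_trans (_ : \sum_(i : I) (M%:R * (2 * b ^+ 2)) ^+ 2 <= _); last first.
  rewrite sumr_const -[leLHS]mulr_natl cardE le_eqVlt; apply/orP; left; apply/eqP.
  by rewrite -cardE; ring.
apply: ler_sum => i _; rewrite -[leRHS](Ex_cst I p); apply: le_Ex => // w.
rewrite -[leLHS]real_normK ?num_real // ler_pXn2r ?nnegrE //.
by rewrite mulr_ge0 // mulr_ge0 ?sqr_ge0.
Qed.

Hypothesis b1 : b <= 1.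
Hypothesis F0 : Ex F = 0.
Hypothesis F1 : Ex (fun w => F w ^+ 2) = 1.

Let Ex_kernel : Ex (stein_kernel F) = 1.
Proof.
rewrite /stein_kernel ExZ Ex_sum -(covariance_dif p F F) F0 mulr0 subr0 -F1.
by apply: eq_Ex => w; rewrite expr2.
Qed.

Variables (phi dphi : R -> R) (C : R).
Hypothesis phiT : forall x y, `|y - x| <= 1 ->
  `|phi y - phi x - dphi x * (y - x)| <= C * (1 + x ^+ 2) * (y - x) ^+ 2.
Hypothesis dphiC : forall x, dphi x ^+ 2 <= C * (1 + x ^+ 2).

Let C0 : 0 <= C.
Proof. by have := dphiC 0; rewrite expr0n addr0 mulr1; apply: le_trans; exact: sqr_ge0. Qed.

Let chain_rule i w :
  `|dif i (phi \o F) w - dphi (F w) * dif i F w| <= C * (1 + F w ^+ 2) * b ^+ 2.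
Proof.
apply: le_trans (_ : C * (1 + F w ^+ 2) * (dif i F w) ^+ 2 <= _); last first.
  apply: ler_wpM2l; first by rewrite mulr_ge0 // addr_ge0 ?sqr_ge0.
  by rewrite -[leLHS]real_normK ?num_real // ler_pXn2r ?nnegrE.
have := dif_le i w; rewrite /dif /=.
have := upd_id w i; case: (w i) => -> d1.
  rewrite distrC in d1; have := phiT (le_trans d1 b1).
  rewrite -normrN; congr (`|_| <= _); ring.
by have := phiT (le_trans d1 b1).
Qed.

(** Stein's equation holds approximately for [F]: integrate by parts with
    [covariance_dif], linearize [phi], and replace the kernel by its mean. *)
Lemma stein_bound (eta : R) : 0 < eta ->
  `|Ex (fun w => F w * phi (F w)) - Ex (fun w => dphi (F w))| <=
  2 * C * #|I|%:R * b ^+ 3 + eta * C + 2 * #|I|%:R * M%:R ^+ 2 * b ^+ 4 / eta.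
Proof.
move=> eta0.
have Ex2 : Ex (fun w => 1 + F w ^+ 2) = 2 by rewrite ExD F1 Ex_cst.
rewrite -(subrKA (Ex (fun w => dphi (F w) * stein_kernel F w))).
apply: le_trans (ler_normD _ _) _; rewrite -addrA lerD //.
  have -> : Ex (fun w => F w * phi (F w)) =
      p * (1 - p) * \sum_i Ex (fun w => avgs (later i) (dif i F) w * dif i (phi \o F) w).
    by rewrite -covariance_dif F0 mul0r subr0.
  have -> : Ex (fun w => dphi (F w) * stein_kernel F w) = p * (1 - p) *
      \sum_i Ex (fun w => avgs (later i) (dif i F) w * (dphi (F w) * dif i F w)).
    rewrite -Ex_sum -ExZ; apply: eq_Ex => w.
    rewrite /stein_kernel mulrCA; congr (_ * _); rewrite big_distrr /=.
    by apply: eq_bigr => i _; ring.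
  rewrite -mulrBr -sumrB normrM (ger0_norm pq_ge0).
  apply: le_trans (_ : 1 * _ <= _); first exact: ler_wpM2r.
  rewrite mul1r; apply: le_trans (ler_norm_sum _ _ _) _.
  apply: le_trans (_ : \sum_(i : I) b * (C * 2 * b ^+ 2) <= _); last first.
    rewrite sumr_const -[leLHS]mulr_natl le_eqVlt; apply/orP; left; apply/eqP.
    by rewrite exprS; ring.
  apply: ler_sum => i _; rewrite -ExB; apply: le_trans (ler_norm_Ex p01 _) _.
  rewrite -Ex2.
  have -> : b * (C * Ex (fun w => 1 + F w ^+ 2) * b ^+ 2) =
            Ex (fun w => b * (C * (1 + F w ^+ 2) * b ^+ 2)).
    rewrite (_ : b * _ = C * b ^+ 3 * Ex (fun w => 1 + F w ^+ 2)); last by ring.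
    by rewrite -ExZ; apply: eq_Ex => w; ring.
  by apply: le_Ex => // w; rewrite -mulrBr normrM ler_pM.
(* Young's inequality separates [dphi] from the fluctuation of the kernel. *)
rewrite -ExB; apply: le_trans (ler_norm_Ex p01 _) _.
have half : 0 < (2 * eta)^-1 by rewrite invr_gt0 mulr_gt0.
apply: le_trans (_ : Ex (fun w => eta / 2 * (C * (1 + F w ^+ 2)) +
   (2 * eta)^-1 * (stein_kernel F w - Ex (stein_kernel F)) ^+ 2) <= _).
  apply: le_Ex => // w; rewrite Ex_kernel.
  rewrite -[X in `|_ - X|]mulr1 -mulrBr.
  set t := _ - 1; set d := dphi _.
  apply: le_trans (_ : eta / 2 * d ^+ 2 + (2 * eta)^-1 * t ^+ 2 <= _); last first.
    by rewrite lerD2r ler_wpM2l ?dphiC // divr_ge0 // ltW.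
  have sq : 0 <= (2 * eta)^-1 * (eta * `|d| - `|t|) ^+ 2.
    by rewrite mulr_ge0 ?sqr_ge0 // ltW.
  rewrite -subr_ge0; apply: le_trans sq _.
  rewrite -[d ^+ 2]real_normK ?num_real // -[t ^+ 2]real_normK ?num_real //.
  rewrite normrM le_eqVlt; apply/orP; left; apply/eqP.
  by field; rewrite gt_eqF.
rewrite ExD (ExZ _ (eta / 2)) (ExZ _ C) Ex2 ExZ; apply: lerD.
  by rewrite le_eqVlt; apply/orP; left; apply/eqP; field.
apply: le_trans (ler_wpM2l (ltW half) Var_stein_kernel) _.
rewrite le_eqVlt; apply/orP; left; apply/eqP.
by field; rewrite gt_eqF.
Qed.

End SecondOrder.

(** * Open clusters in a finite graph *)

Section Clusters.
Variables (T I : finType) (inc : I -> {set T}).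

Local Notation cube := {ffun I -> bool}.
Implicit Types (w : cube) (i j : I) (v x y u : T) (A B : {set T}).

(** An open edge also relates each of its ends to itself, which leaves the
    connected components unchanged. *)
Definition orel w : rel T :=
  [rel x y | [exists i, [&& w i, x \in inc i & y \in inc i]]].

Definition cluster w v : {set T} := [set u | connect (orel w) v u].

Definition touch i A : bool := [exists x, (x \in inc i) && (x \in A)].

Lemma touchP i A : reflect (exists2 x, x \in inc i & x \in A) (touch i A).
Proof.
by apply: (iffP existsP) => [[x /andP[]]|[x xi xA]]; exists x => //; rewrite xi.
Qed.

Lemma orelP w x y :
  reflect (exists i, [/\ w i, x \in inc i & y \in inc i]) (orel w x y).
Proof. by apply: (iffP existsP) => -[i /and3P ?]; exists i. Qed.

Lemma orel_sym w : symmetric (orel w).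
Proof.
by move=> x y; apply/orelP/orelP => -[i [? ? ?]]; exists i.
Qed.

Lemma cluster_refl w v : v \in cluster w v.
Proof. by rewrite inE connect0. Qed.

Lemma card_cluster_gt0 w v : (0 < #|cluster w v|)%N.
Proof. by apply/card_gt0P; exists v; exact: cluster_refl. Qed.

Lemma eq_cluster w v u : u \in cluster w v -> cluster w u = cluster w v.
Proof.
rewrite inE => vu; apply/setP => z; rewrite !inE.
have cs := sym_connect_sym (orel_sym w).
by rewrite (same_connect cs vu).
Qed.

Lemma sub_cluster w v A : v \in A ->
  (forall x y, x \in A -> orel w x y -> y \in A) -> cluster w v \subset A.
Proof.
move=> vA cl; apply/fintype.subsetP => u; rewrite inE => /connectP[s sp ->].
by elim: s v vA sp => //= a s IH v vA /andP[va /IH]; apply; exact: cl va.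
Qed.

Lemma cluster_step w v x y : x \in cluster w v -> orel w x y -> y \in cluster w v.
Proof. by rewrite !inE => vx xy; apply: connect_trans vx (connect1 xy). Qed.

Lemma cluster_mono w w' v : (forall i, w i -> w' i) ->
  cluster w v \subset cluster w' v.
Proof.
move=> ww; apply: sub_cluster; first exact: cluster_refl.
move=> x y xC /orelP[i [/ww wi xi yi]]; apply: (cluster_step xC).
by apply/orelP; exists i.
Qed.

(** The exploration of a cluster never looks at an edge that does not touch it. *)
Lemma cluster_local w w' v :
  (forall i, touch i (cluster w v) -> w i = w' i) -> cluster w' v = cluster w v.
Proof.
move=> ww; apply/eqP; rewrite finset.eqEsubset; apply/andP; split.
  apply: sub_cluster; first exact: cluster_refl.
  move=> x y xC /orelP[i [wi xi yi]]; apply: (cluster_step xC).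
  by apply/orelP; exists i; split=> //; rewrite ww //; apply/touchP; exists x.
suff /fintype.subsetP h : cluster w v \subset cluster w v :&: cluster w' v.
  by apply/fintype.subsetP => x /h; rewrite inE => /andP[].
apply: sub_cluster; first by rewrite inE !cluster_refl.
move=> x y; rewrite inE => /andP[xC xC'] /[dup] xy /orelP[i [wi xi yi]].
rewrite inE (cluster_step xC xy) /=; apply: (cluster_step xC').
by apply/orelP; exists i; split=> //; rewrite -ww //; apply/touchP; exists x.
Qed.

Lemma cluster_upd w i b v : ~~ touch i (cluster w v) ->
  cluster (upd w i b) v = cluster w v.
Proof.
move=> ti; apply: cluster_local => j tj; rewrite upd_ne //.
by apply: contra ti => /eqP <-.
Qed.

Lemma cluster_upd_le w i v :
  cluster (upd w i false) v \subset cluster (upd w i true) v.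
Proof.
by apply: cluster_mono => j; rewrite !ffunE; case: eqP.
Qed.

Lemma touch_upd w i v b : touch i (cluster (upd w i b) v) = touch i (cluster w v).
Proof.
apply/idP/idP; apply: contraLR => h; first by rewrite cluster_upd.
by rewrite -(upd_id w i) -(upd_upd w i b) cluster_upd.
Qed.

Hypothesis inc2 : forall i, #|inc i| = 2%N.
Variable D : nat.
Hypothesis deg : forall x, (#|[set i | x \in inc i]| <= D)%N.

Lemma card_touch A : (#|[set i | touch i A]| <= D * #|A|)%N.
Proof.
have /subset_leq_card h : [set i | touch i A] \subset
    \bigcup_(x in A) [set i | x \in inc i].
  apply/fintype.subsetP => i; rewrite inE => /touchP[x xi xA].
  by apply/bigcupP; exists x => //; rewrite inE.
apply: leq_trans h _; apply: leq_trans (_ : \sum_(x in A) D <= _)%N.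
  elim/big_rec2: _ => [|x m B xA IH]; first by rewrite cards0.
  apply: leq_trans (leq_card_setU _ _) _.
  by apply: leq_add => //; exact: deg.
by rewrite sum_nat_const mulnC.
Qed.

(** ** Balls of the underlying graph *)

Definition near_rel : rel T :=
  [rel x y | (x == y) || [exists i, (x \in inc i) && (y \in inc i)]].

Definition nb A : {set T} := [set y | [exists x, (x \in A) && near_rel x y]].

Definition nball m v : {set T} := iter m nb [set v].

Lemma near_sym : symmetric near_rel.
Proof.
move=> x y; rewrite /near_rel /= eq_sym; congr (_ || _).
by apply: eq_existsb => i; rewrite andbC.
Qed.

Lemma nbP A y : reflect (exists2 x, x \in A & near_rel x y) (y \in nb A).
Proof.
rewrite inE; apply: (iffP existsP) => [[x /andP[]]|[x xA xy]]; exists x => //.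
by rewrite xA.
Qed.

Lemma nb_mono A B : A \subset B -> nb A \subset nb B.
Proof.
move=> /fintype.subsetP AB; apply/fintype.subsetP => y /nbP[x /AB xB xy].
by apply/nbP; exists x.
Qed.

Lemma iter_nb_mono m A B : A \subset B -> iter m nb A \subset iter m nb B.
Proof. by move=> AB; elim: m => //= m IH; exact: nb_mono. Qed.

Lemma sub_nb A : A \subset nb A.
Proof. by apply/fintype.subsetP => x xA; apply/nbP; exists x => //; rewrite /near_rel /= eqxx. Qed.

Lemma nball_sym m u v : u \in nball m v -> v \in nball m u.
Proof.
rewrite /nball; elim: m u => [|m IH] u /=; first by rewrite !inE eq_sym.
move=> /nbP[x /IH vx xu]; rewrite -iterS iterSr.
apply: (fintype.subsetP (iter_nb_mono m _)) vx; apply/fintype.subsetP => z; rewrite inE => /eqP ->.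
by apply/nbP; exists u; rewrite ?inE // near_sym.
Qed.

Lemma card_nb A : (#|nb A| <= (2 * D + 1) * #|A|)%N.
Proof.
have /subset_leq_card h : nb A \subset A :|: \bigcup_(i in [set i | touch i A]) inc i.
  apply/fintype.subsetP => y /nbP[x xA]; rewrite inE => /orP[/eqP <-|/existsP[i /andP[xi yi]]].
    by rewrite xA.
  apply/orP; right; apply/bigcupP; exists i => //.
  by rewrite inE; apply/touchP; exists x.
apply: leq_trans h _; apply: leq_trans (leq_card_setU _ _) _.
rewrite mulnDl mul1n addnC leq_add2r.
apply: leq_trans (_ : \sum_(i in [set i | touch i A]) 2 <= _)%N.
  elim/big_rec2: _ => [|i m B _ IH]; first by rewrite cards0.
  by apply: leq_trans (leq_card_setU _ _) _; rewrite inc2 leq_add2l.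
by rewrite sum_nat_const mulnC -mulnA leq_mul2l card_touch.
Qed.

Lemma card_nball m v : (#|nball m v| <= (2 * D + 1) ^ m)%N.
Proof.
elim: m => [|m IH]; first by rewrite cards1.
apply: leq_trans (card_nb _) _; rewrite expnS leq_mul2l.
by rewrite [X in _ || X]IH orbT.
Qed.

(** A self-avoiding open path inside a small cluster is short. *)
Lemma cluster_sub_nball m w v : (#|cluster w v| <= m)%N ->
  cluster w v \subset nball m v.
Proof.
move=> Cm; apply/fintype.subsetP => u; rewrite inE => /connectP[s sp ->].
case/shortenP: sp => s' sp us _ {s u}.
have ball : forall s x, path (orel w) x s -> last x s \in nball (size s) x.
  elim/last_ind => [|s y IH] x /=; first by rewrite inE.
  rewrite rcons_path last_rcons size_rcons => /andP[/IH h /orelP[i [_ xi yi]]].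
  apply/nbP; exists (last x s) => //; apply/orP; right.
  by apply/existsP; exists i; rewrite xi.
have sm : (size s' <= m)%N.
  apply: leq_trans Cm; rewrite -[size s']/((size (v :: s')).-1) -(card_uniqP us).
  apply: leq_trans (leq_pred _) _.
  apply/subset_leq_card/fintype.subsetP => z zs.
  by rewrite inE; apply: (path_connect sp).
rewrite -(subnK sm) /nball iterD; have := ball _ _ sp.
by elim: (m - size s')%N => //= k IH /IH; apply: (fintype.subsetP (sub_nb _)).
Qed.

Variable R : realType.

Definition cluster_sum (kappa : nat -> R) w : R :=
  \sum_v kappa #|cluster w v|.

(** The reciprocal sizes add up to one over each cluster, and an edge touches at
    most two clusters. *)
Lemma touched_sum_le w i :
  \sum_(v | touch i (cluster w v)) (#|cluster w v|%:R)^-1 <= 2%:R :> R.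
Proof.
have one x : \sum_(v in cluster w x) (#|cluster w v|%:R)^-1 = 1 :> R.
  rewrite (eq_bigr (fun=> (#|cluster w x|%:R)^-1)); last first.
    by move=> v /eq_cluster ->.
  rewrite sumr_const -[LHS]mulr_natr mulVf // pnatr_eq0 -lt0n.
  exact: card_cluster_gt0.
have -> : 2%:R = \sum_(x in inc i) \sum_(v in cluster w x) (#|cluster w v|%:R)^-1 :> R.
  by under eq_bigr do rewrite one; rewrite sumr_const inc2.
rewrite (exchange_big_dep (fun v => touch i (cluster w v))) /=; last first.
  move=> x v xi vx; apply/touchP; exists x => //.
  by rewrite (eq_cluster vx) cluster_refl.
apply: ler_sum => v /touchP[x xi xv].
have vx : v \in cluster w x by rewrite (eq_cluster xv) cluster_refl.
rewrite (bigD1 x) /= ?xi // lerDl; apply: sumr_ge0 => y _.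
by rewrite invr_ge0.
Qed.

Section Profile.
Variable kappa : nat -> R.
Hypothesis kappa_ge0 : forall s, 0 <= kappa s.
Hypothesis kappa_le : forall s, (0 < s)%N -> kappa s <= s%:R^-1.
Hypothesis kappa_mono : forall s t, (0 < s)%N -> (s <= t)%N -> kappa t <= kappa s.

Lemma cluster_sum_term_le i w v :
  kappa #|cluster (upd w i true) v| <= kappa #|cluster (upd w i false) v|.
Proof.
apply: kappa_mono; first exact: card_cluster_gt0.
exact/subset_leq_card/cluster_upd_le.
Qed.

Lemma dif_cluster_sum_le0 i w : dif i (cluster_sum kappa) w <= 0.
Proof.
by rewrite subr_le0; apply: ler_sum => v _; exact: cluster_sum_term_le.
Qed.

Lemma dif_cluster_sum_ge i w : - 2 <= dif i (cluster_sum kappa) w.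
Proof.
rewrite lerNl /dif opprB /cluster_sum -sumrB.
rewrite (bigID (fun v => touch i (cluster (upd w i false) v))) /= addrC big1; last first.
  move=> v; rewrite touch_upd => h.
  by rewrite !cluster_upd // subrr.
rewrite add0r; apply: le_trans (touched_sum_le (upd w i false) i).
apply: ler_sum => v _; rewrite lerBlDr ler_wpDr //.
by apply: kappa_le; exact: card_cluster_gt0.
Qed.

Lemma norm_dif_cluster_sum i w : `|dif i (cluster_sum kappa) w| <= 2.
Proof.
rewrite ler_norml dif_cluster_sum_ge /=.
by apply: le_trans (dif_cluster_sum_le0 i w) _.
Qed.

End Profile.

End Clusters.

(** * Fluctuations of sums over clusters *)

Section Percolation.
Variables (R : realType) (T I : finType) (inc : I -> {set T}) (p : R) (D : nat).
Hypothesis p01 : 0 < p < 1.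
Hypothesis inc2 : forall i, #|inc i| = 2%N.
Hypothesis deg : forall x, (#|[set i | x \in inc i]| <= D)%N.

Local Notation cube := {ffun I -> bool}.
Local Notation Ex := (Ex p).
Local Notation Var := (Var p).
Local Notation cluster := (cluster inc).
Local Notation touch := (touch inc).
Local Notation cluster_sum := (@cluster_sum T I inc R).
Implicit Types (w : cube) (i j : I) (v x y : T) (A : {set T}).

Let p0 : 0 < p. Proof. by case/andP: p01. Qed.
Let q0 : 0 < 1 - p. Proof. by rewrite subr_gt0; case/andP: p01. Qed.
Let pq_ge0 : 0 <= p * (1 - p). Proof. by rewrite mulr_ge0 ?ltW. Qed.
Let pq_le1 : p * (1 - p) <= 1. Proof. by case/andP: p01 => ? ?; nra. Qed.

Lemma Ex_mul_indep (s : seq I) (q : bool -> R) (f : cube -> R) :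
  p * q true + (1 - p) * q false = 1 -> uniq s ->
  (forall i w, i \in s -> dif i f w = 0) ->
  Ex (fun w => f w * \prod_(i <- s) q (w i)) = Ex f.
Proof.
move=> q1; elim: s => [|i s IH] /=.
  by move=> _ _; apply: eq_Ex => w; rewrite big_nil mulr1.
move=> /andP[si us] f0; rewrite -IH //; last first.
  by move=> j w js; apply: f0; rewrite inE js orbT.
rewrite -(Ex_avg p i (fun w => f w * \prod_(j <- i :: s) _)); apply: eq_Ex => w.
rewrite (@eq_avg _ _ _ _ _ (fun w => (f w * \prod_(j <- s) q (w j)) * q (w i))); last first.
  by move=> v; rewrite big_cons mulrAC mulrA.
rewrite avg_mul /avg ?upd_at ?q1 ?mulr1 // => v.
have h b : \prod_(j <- s) q (upd v i b j) = \prod_(j <- s) q (v j).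
  rewrite !big_seq; apply: eq_bigr => j js; rewrite upd_ne //.
  by apply: contraNneq si => <-.
have := f0 i v (mem_head _ _); rewrite /dif => /eqP; rewrite subr_eq0 => /eqP e.
by rewrite /dif !h e subrr.
Qed.

(** The event that the cluster of [v] is a given set [A] depends only on the
    edges touching [A].  The factors of the other edges are independent of it, so
    they can be inserted without changing the mean; summing over [A] leaves the
    mean of the product over all edges. *)
Lemma Ex_cluster_prod (q : bool -> R) v :
  p * q true + (1 - p) * q false = 1 ->
  Ex (fun w => \prod_(i | touch i (cluster w v)) q (w i)) = 1.
Proof.
move=> q1.
pose F A w := (cluster w v == A)%:R * \prod_(i | touch i A) q (w i).
have -> : Ex (fun w => \prod_(i | touch i (cluster w v)) q (w i)) =
          \sum_(A : {set T}) Ex (F A).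
  rewrite -Ex_sum; apply: eq_Ex => w; rewrite (bigD1 (cluster w v)) //= /F eqxx mul1r.
  rewrite [X in _ = _ + X]big1 ?addr0 // => A; rewrite eq_sym => /negbTE ->; exact: mul0r.
have E A : Ex (F A) = Ex (fun w => (cluster w v == A)%:R * \prod_i q (w i)).
  rewrite -(@Ex_mul_indep (enum [pred i | ~~ touch i A]) q (F A)) ?enum_uniq //.
    apply: eq_Ex => w; rewrite /F -mulrA; congr (_ * _).
    by rewrite big_enum /= [in RHS](bigID (fun i => touch i A)).
  move=> i w; rewrite mem_enum inE => ti; apply/eqP; rewrite subr_eq0; apply/eqP.
  rewrite /F; congr (_%:R * _).
    congr nat_of_bool; apply/eqP/eqP => h.
      by rewrite -(upd_upd w i true) cluster_upd h.
    by rewrite -(upd_upd w i false) cluster_upd h.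
  apply: eq_bigr => j tj; rewrite !upd_ne //.
    by apply: contraNneq ti => <-.
  by apply: contraNneq ti => <-.
under eq_bigr do rewrite E.
rewrite -Ex_sum -[RHS](Ex_cst I p).
have -> : Ex (fun _ : cube => 1) = Ex (fun w : cube => \prod_i q (w i)).
  by rewrite Ex_cst (Ex_prod p (fun=> q)) big1.
apply: eq_Ex => w; rewrite (bigD1 (cluster w v)) //= eqxx mul1r.
rewrite [X in _ + X]big1 ?addr0 // => A; rewrite eq_sym => /negbTE ->; exact: mul0r.
Qed.

Lemma expR_le_1Dx (x : R) : - 2^-1 <= x -> expR (x - 2 * x ^+ 2) <= 1 + x.
Proof.
move=> x2; have := expR_ge1Dx (- (x - 2 * x ^+ 2)).
set y := x - _ => h.
have d0 : 0 < 1 - y.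
  by rewrite /y; have := sqr_ge0 (x - 4^-1); nra.
have x1 : 0 < 1 + x by lra.
rewrite expRN in h.
rewrite -[leLHS]invrK -[leRHS]invrK lef_pV2 ?posrE ?invr_gt0 ?expR_gt0 //.
apply: le_trans h; rewrite -[leLHS]mul1r ler_pdivrMr //.
rewrite /y; have := sqr_ge0 x => x20.
have -> : (1 + - (x - 2 * x ^+ 2)) * (1 + x) = 1 + x ^+ 2 * (1 + 2 * x) by ring.
by rewrite lerDl mulr_ge0 //; lra.
Qed.

(** The number of closed edges touching the cluster of [v], each centred by its
    mean. *)
Definition excess w v : R :=
  \sum_(i | touch i (cluster w v)) (p - (w i)%:R).

(** Each factor [1 + x] is at least [exp (x - 2 x^2)], so the product dominates
    the exponential of a linear function of the excess. *)
Lemma excess_le (lam : R) w v : 0 < lam <= 2^-1 ->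
  lam * excess w v <=
    2 * lam ^+ 2 * #|[set i | touch i (cluster w v)]|%:R +
    \prod_(i | touch i (cluster w v)) (1 + lam * (p - (w i)%:R)).
Proof.
move=> /andP[l0 l2].
have x1 i : `|p - (w i)%:R| <= 1.
  by case: (w i) => /=; rewrite ler_norml; move: p01 => /andP[? ?]; apply/andP; split; lra.
set P := \prod_(i | _) _.
set t := #|_|%:R.
have h : expR (lam * excess w v - 2 * lam ^+ 2 * t) <= P.
  rewrite /P /excess /t -sum1_card natr_sum.
  rewrite big_distrr [X in _ - X]big_distrr /= big_mkcond [X in _ - X]big_mkcond /=.
  rewrite -sumrB expR_sum [leRHS]big_mkcond /=.
  apply: ler_prod => i _; rewrite expR_ge0 /= inE.
  case: ifP => _; last by rewrite subr0 expR0.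
  set x := lam * _.
  have xl : `|x| <= lam by rewrite normrM gtr0_norm // ler_piMr // ltW.
  apply: le_trans (_ : expR (x - 2 * x ^+ 2) <= _); last first.
    by apply: expR_le_1Dx; move: xl; rewrite ler_norml => /andP[? ?]; lra.
  rewrite ler_expR lerD2l lerN2 mulr1 ler_wpM2l //.
  by rewrite -[leLHS]real_normK ?num_real // ler_pXn2r ?nnegrE // ltW.
rewrite -lerBlDl; apply: le_trans h.
by apply: le_trans (expR_ge1Dx _); rewrite lerDr.
Qed.

Section Profile.
Variable kappa : nat -> R.
Hypothesis kappa_ge0 : forall s, 0 <= kappa s.
Hypothesis kappa_le : forall s, (0 < s)%N -> kappa s <= s%:R^-1.
Hypothesis kappa_mono : forall s t, (0 < s)%N -> (s <= t)%N -> kappa t <= kappa s.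

(** A vertex only feels edge [i] if [i] touches its cluster, and whether it does
    so is independent of the state of [i].  The mean derivative in [i] is therefore
    a correlation of [p - w i] with the summands of the touched vertices. *)
Lemma sum_Ex_dif_cluster_sum :
  p * (1 - p) * \sum_i Ex (dif i (cluster_sum kappa)) =
  - Ex (fun w => \sum_v kappa #|cluster w v| * excess w v).
Proof.
have term i : p * (1 - p) * Ex (dif i (cluster_sum kappa)) =
    - Ex (fun w => (p - (w i)%:R) * \sum_(v | touch i (cluster w v)) kappa #|cluster w v|).
  pose g w := \sum_(v | touch i (cluster w v)) kappa #|cluster w v|.
  have := Ex_mul_dif p i (fun w => (w i)%:R - p) g.
  have -> : Ex (fun w => avg p i (fun w => (w i)%:R - p) w * g w) = 0.
    rewrite -[RHS](Ex_cst I p); apply: eq_Ex => w.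
    by rewrite /avg !upd_at /=; ring.
  have -> : Ex (fun w => dif i (fun w => (w i)%:R - p) w * dif i g w) =
            Ex (dif i (cluster_sum kappa)).
    apply: eq_Ex => w; rewrite {1}/dif !upd_at /= (_ : _ - _ = 1); last by ring.
    rewrite mul1r.
    have sumE b : cluster_sum kappa (upd w i b) = g (upd w i b) +
        \sum_(v | ~~ touch i (cluster w v)) kappa #|cluster w v|.
      rewrite /cluster_sum (bigID (fun v => touch i (cluster (upd w i b) v))) /=.
      congr (_ + _); apply: eq_big => v; first by rewrite touch_upd.
      by rewrite touch_upd => h; rewrite cluster_upd.
    by rewrite /dif !sumE; ring.
  rewrite subr0 => <-; rewrite -ExN; apply: eq_Ex => w.
  by rewrite -mulNr opprB.
rewrite big_distrr /= (eq_bigr _ (fun i _ => term i)) sumrN; congr (- _).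
rewrite -Ex_sum; apply: eq_Ex => w.
under eq_bigr do rewrite big_distrr /=.
rewrite (exchange_big_dep predT) //=; apply: eq_bigr => v _.
by rewrite big_distrr /=; apply: eq_bigr => i _; rewrite mulrC.
Qed.

(** By Efron-Stein and monotonicity only the mean of the weighted excess matters.
    In the bound [excess_le] for it, the number of touching edges is at most [D]
    times the size of the cluster, which the weight [kappa] compensates; the
    product has mean one and weight at most [1 / n]. *)
Lemma Var_cluster_sum_le (n : nat) (lam : R) : (0 < n)%N -> 0 < lam <= 2^-1 ->
  (forall s, kappa s <= n%:R^-1) ->
  Var (cluster_sum kappa) <=
    2 * #|T|%:R * (2 * lam * D%:R + (lam * n%:R)^-1).
Proof.
move=> n0 lam01 kappa_n; have /andP[l0 l2] := lam01.
apply: le_trans (Efron_Stein p01 _) _.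
apply: le_trans (_ : 2 * Ex (fun w => \sum_v kappa #|cluster w v| * excess w v) <= _).
  rewrite -[X in 2 * X]opprK -sum_Ex_dif_cluster_sum -mulrN mulrCA ler_wpM2l //.
  rewrite -sumrN big_distrr /=; apply: ler_sum => i _.
  rewrite -ExN -ExZ; apply: le_Ex => // w.
  have := dif_cluster_sum_le0 inc kappa_mono i w.
  have := dif_cluster_sum_ge inc2 kappa_ge0 kappa_le i w; nra.
rewrite -mulrA ler_wpM2l //.
pose Pr w v := \prod_(i | touch i (cluster w v)) (1 + lam * (p - (w i)%:R)).
apply: le_trans (_ : Ex (fun w => \sum_v
    (2 * lam * D%:R + (lam * n%:R)^-1 * Pr w v)) <= _).
  apply: le_Ex => // w; apply: ler_sum => v _.
  rewrite -(ler_pM2l l0).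
  rewrite mulrCA; apply: le_trans (ler_wpM2l (kappa_ge0 _) (excess_le w v lam01)) _.
  have C0 := card_cluster_gt0 inc w v.
  rewrite -/(Pr w v) !mulrDr; apply: lerD; last first.
    rewrite invfM !mulrA mulfV ?gt_eqF // mul1r ler_wpM2r //.
    apply: prodr_ge0 => i _.
    have : 0 <= p - (w i)%:R + 1.
      by move: (ltW p0) (ltW q0); case: (w i) => /=; lra.
    by move=> /(mulr_ge0 (ltW l0)); rewrite mulrDr mulr1; lra.
  rewrite mulrCA (_ : lam * _ = 2 * lam ^+ 2 * D%:R); last by ring.
  apply: ler_wpM2l; first by rewrite mulr_ge0 ?sqr_ge0.
  apply: le_trans (_ : #|cluster w v|%:R^-1 * (D%:R * #|cluster w v|%:R) <= _).
    apply: ler_pM => //; first exact: kappa_le.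
    by rewrite -natrM ler_nat card_touch.
  by rewrite mulrCA mulVf ?mulr1 // pnatr_eq0 -lt0n.
rewrite Ex_sum (eq_bigr (fun=> 2 * lam * D%:R + (lam * n%:R)^-1)).
  by rewrite sumr_const -[leLHS]mulr_natl.
move=> v _; rewrite ExD Ex_cst ExZ (@Ex_cluster_prod (fun b => 1 + lam * (p - b%:R))) ?mulr1 //.
by rewrite /=; ring.
Qed.

(** If every other edge at an endpoint is closed, opening [i] absorbs an
    isolated vertex. *)
Lemma Ex_dif_cluster_sum_le i : 2^-1 <= kappa 1%N - kappa 2%N ->
  Ex (dif i (cluster_sum kappa)) <= - (2^-1 * (1 - p) ^+ D).
Proof.
move=> k12.
have [x [y [xi yi xy]]] : exists x y, [/\ x \in inc i, y \in inc i & x != y].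
  have /eqP/cards2P[x [y [xy e]]] := inc2 i.
  by exists x, y; rewrite e !inE !eqxx orbT.
pose B := [set j | x \in inc j] :\ i.
have EB : Ex (fun w => \prod_(j in B) (1 - (w j)%:R)) = (1 - p) ^+ #|B|.
  transitivity (Ex (fun w => \prod_j (if j \in B then 1 - (w j)%:R else 1))).
    by apply: eq_Ex => w; rewrite big_mkcond.
  rewrite (Ex_prod p (fun j b => if j \in B then 1 - b%:R else 1)).
  rewrite -prodr_const [RHS]big_mkcond; apply: eq_bigr => j _.
  by case: ifP => _ /=; ring.
apply: le_trans (_ : - (2^-1 * (1 - p) ^+ #|B|) <= _); last first.
  rewrite lerN2 ler_wpM2l ?invr_ge0 //.
  have BD : (#|B| <= D)%N.
    by apply: leq_trans (deg x); apply/subset_leq_card; exact: subD1set.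
  rewrite -(subnK BD) exprD ler_piMl ?exprn_ge0 ?(ltW q0) //.
  by apply: exprn_ile1; rewrite ?(ltW q0) // lerBlDr lerDl (ltW p0).
rewrite -EB -ExZ -ExN; apply: le_Ex => // w.
have [/existsP[j /andP[jB wj]]|/existsPn closed] := boolP [exists j in B, w j].
  rewrite (bigD1 j) //= wj subrr mul0r mulr0 oppr0.
  exact: dif_cluster_sum_le0.
rewrite big1 ?mulr1; last first.
  by move=> j jB; have := closed j; rewrite jB /= => /negbTE ->; rewrite subr0.
rewrite /dif /cluster_sum -sumrB (bigD1 x) //=.
rewrite -[leRHS]addr0 lerD //; last first.
  by apply: sumr_le0 => v _; rewrite subr_le0; exact: cluster_sum_term_le.
have -> : cluster (upd w i false) x = [set x].
  apply/eqP; rewrite finset.eqEsubset finset.sub1set cluster_refl andbT.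
  apply: sub_cluster; first by rewrite inE.
  move=> a b; rewrite inE => /eqP -> /orelP[j []].
  rewrite ffunE; case: eqP => // /eqP ji wj xj _.
  by have := closed j; rewrite !inE ji xj wj.
rewrite cards1.
have : kappa #|cluster (upd w i true) x| <= kappa 2%N.
  apply: kappa_mono => //; rewrite -(_ : #|[set x; y]| = 2%N); last by rewrite cards2 xy.
  apply/subset_leq_card/fintype.subsetP => z; rewrite !inE => /orP[] /eqP ->.
    by rewrite connect0.
  by apply: connect1; apply/orelP; exists i; rewrite upd_at.
lra.
Qed.

Lemma Var_cluster_sum_ge : 2^-1 <= kappa 1%N - kappa 2%N ->
  p * (1 - p) * (2^-1 * (1 - p) ^+ D) ^+ 2 * #|I|%:R <= Var (cluster_sum kappa).
Proof.
move=> k12; apply: le_trans (Var_ge_dif p01 _).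
rewrite -mulrA ler_wpM2l //.
apply: le_trans (_ : \sum_(i : I) (2^-1 * (1 - p) ^+ D) ^+ 2 <= _).
  by rewrite sumr_const -[leRHS]mulr_natr.
apply: ler_sum => i _; have := Ex_dif_cluster_sum_le i k12.
rewrite lerNr => h; rewrite -[leRHS]sqrrN ler_pXn2r ?nnegrE //.
  by rewrite mulr_ge0 ?invr_ge0 ?exprn_ge0 ?ltW.
by apply: le_trans h; rewrite mulr_ge0 ?invr_ge0 ?exprn_ge0 ?ltW.
Qed.

(** Clusters that could leave the ball of radius [n] around a vertex have weight
    zero, so the summand of the vertex depends on the edges touching this ball
    only, and two interacting edges touch a common ball. *)
Lemma card_interacting (n : nat) : (forall s, (n <= s)%N -> kappa s = 0) ->
  forall j, (#|interacting (cluster_sum kappa) j| <=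
              2 * (2 * D + 1) ^ n * (D * (2 * D + 1) ^ n))%N.
Proof.
move=> kappa0 j.
pose S v := [set i | touch i (nball inc n v)].
pose X v w := kappa #|cluster w v|.
have Xloc v w w' : (forall i, i \in S v -> w i = w' i) -> X v w = X v w'.
  have half (u u' : cube) : (forall i, i \in S v -> u i = u' i) ->
      (#|cluster u v| <= n)%N -> X v u = X v u'.
    move=> uu Cn; rewrite /X (@cluster_local _ _ _ u u') // => i /touchP[x xi xC].
    apply: uu; rewrite inE; apply/touchP; exists x => //.
    exact: (fintype.subsetP (cluster_sub_nball Cn)).
  move=> ww; have [h|h] := leqP #|cluster w v| n; first exact: half.
  have [h'|h'] := leqP #|cluster w' v| n.
    by apply/esym/half => // i /ww.
  by rewrite /X !kappa0 // ltnW.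
have dX i v w : i \notin S v -> dif i (X v) w = 0.
  move=> iS; apply/eqP; rewrite subr_eq0; apply/eqP/Xloc => k kS.
  by rewrite !upd_ne //; apply: contraNneq iS => <-.
have sub : interacting (cluster_sum kappa) j \subset
    \bigcup_(v in [set v | j \in S v]) S v.
  apply/fintype.subsetP => i; rewrite inE => /existsP[w].
  have -> : dif j (dif i (cluster_sum kappa)) w = \sum_v dif j (dif i (X v)) w.
    by rewrite /dif /cluster_sum -!sumrB.
  apply: contraR => /bigcupP h; apply/eqP; apply: big1 => v _.
  have [iS|iS] := boolP (i \in S v); last by rewrite {1}/dif !dX // subrr.
  have [jS|jS] := boolP (j \in S v); first by case: h; exists v; rewrite // inE.
  have e b : dif i (X v) (upd w j b) = X v (upd w i true) - X v (upd w i false).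
    by congr (_ - _); apply: Xloc => k kS; rewrite !ffunE;
      case: eqP => // _; case: eqP => // kj; rewrite -kj kS in jS.
  by rewrite {1}/dif !e subrr.
apply: leq_trans (subset_leq_card sub) _.
have cS v : (#|S v| <= D * (2 * D + 1) ^ n)%N.
  apply: leq_trans (card_touch deg _) _; rewrite leq_mul2l.
  by rewrite (card_nball inc2 deg) orbT.
apply: leq_trans (_ : \sum_(v in [set v | j \in S v]) D * (2 * D + 1) ^ n <= _)%N.
  elim/big_rec2: _ => [|v m B _ IH]; first by rewrite cards0.
  by apply: leq_trans (leq_card_setU _ _) _; exact: leq_add.
rewrite sum_nat_const leq_mul2r; apply/orP; right.
have /subset_leq_card h : [set v | j \in S v] \subset \bigcup_(x in inc j) nball inc n x.
  apply/fintype.subsetP => v; rewrite !inE => /touchP[x xj xB].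
  by apply/bigcupP; exists x => //; exact: nball_sym.
apply: leq_trans h _.
apply: leq_trans (_ : \sum_(x in inc j) (2 * D + 1) ^ n <= _)%N.
  elim/big_rec2: _ => [|v m B _ IH]; first by rewrite cards0.
  apply: leq_trans (leq_card_setU _ _) _; apply: leq_add => //.
  exact: card_nball.
by rewrite sum_nat_const inc2.
Qed.

End Profile.

End Percolation.

Local Open Scope classical_set_scope.
Local Open Scope ring_scope.

(** * The Gaussian Stein equation *)

Section Gauss.
Variable R : realType.
Local Notation mu := (@lebesgue_measure R).
Local Notation gauss := (@normal_pdf R 0 1).

Definition normal_cdf (x : R) : R := fine (normal_prob 0 1 `]-oo, x]).

Let idR : measurableTypeR R -> R := idfun.

#[local] HB.instance Definition _ :=
  @isMeasurableFun.Build _ _ _ _ idR (@measurable_id _ _ setT).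

Let normal_cdf_Ny : normal_cdf @ -oo --> (0 : R).
Proof.
apply: fine_cvg; have := @cvg_cdfNy0 _ _ _ (normal_prob (R := R) 0 1) idR.
by rewrite /cdf /distribution /pushforward /=; under eq_fun do rewrite preimage_id.
Qed.

Let normal_cdf_y : normal_cdf @ +oo --> (1 : R).
Proof.
apply: fine_cvg; have := @cvg_cdfy1 _ _ _ (normal_prob (R := R) 0 1) idR.
by rewrite /cdf /distribution /pushforward /=; under eq_fun do rewrite preimage_id.
Qed.

Let gaussE x : gauss x = normal_peak 1 * expR (- x ^+ 2 / 2).
Proof.
by rewrite normal_pdfE ?oner_neq0 // /normal_fun subr0 expr1n.
Qed.

Lemma gauss_gt0 x : 0 < gauss x.
Proof. by rewrite gaussE mulr_gt0 ?expR_gt0 // normal_peak_gt0 ?oner_neq0. Qed.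

Lemma is_derive_gauss (x : R) : is_derive x 1 gauss (- x * gauss x).
Proof.
rewrite gaussE; have -> : gauss = normal_peak 1 *: (expR \o (fun y : R => (- 2^-1) *: y ^+ 2)).
  by apply/funext => y; rewrite gaussE /=; congr (_ * expR _); rewrite /GRing.scale /=; ring.
have scaleE (a b : R) : a *: b = a * b by [].
apply: is_derive_eq; rewrite !scaleE.
have -> : - x ^+ 2 / 2 = - 2^-1 * x ^+ 2 by ring.
by field.
Qed.

Lemma le_mvt (f df : R -> R) (x y : R) : (forall z : R, is_derive z (1 : R) f (df z)) ->
  x <= y -> exists2 z, x <= z <= y & f y - f x = df z * (y - x).
Proof.
move=> fd xy; have [z|z zI e] := MVT_segment xy (fun z _ => fd z).
  apply: continuous_subspaceT => t.
  by apply: differentiable_continuous; apply/derivable1_diffP; have [] := fd t.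
by exists z.
Qed.

Section Bound.
Variable k : R -> R.
Hypothesis k_cont : continuous k.
Hypothesis k_le1 : forall x, `|k x| <= 1.
Hypothesis k_int0 : \int[mu]_x (k x * gauss x) = 0.

Let kg x := k x * gauss x.
Let G (x : R) : R := \int[mu]_(t in `]-oo, x]) kg t.

Let int_gauss (D : set (measurableTypeR R)) : measurable D -> mu.-integrable D (EFin \o gauss).
Proof.
by move=> mD; apply: integrableS (integrable_normal_pdf 0 1) => //.
Qed.

Let m_kg : measurable_fun setT kg.
Proof.
apply: measurable_funM; first exact: continuous_measurable_fun.
exact: measurable_normal_pdf.
Qed.

Let kg_le x : `|kg x| <= gauss x.
Proof.
by rewrite normrM (ger0_norm (normal_pdf_ge0 _ _ _)) ler_piMl ?normal_pdf_ge0.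
Qed.

Let int_kg (D : set (measurableTypeR R)) : measurable D -> mu.-integrable D (EFin \o kg).
Proof.
move=> mD; apply: le_integrable (int_gauss mD) => //.
  by apply/measurable_EFinP; exact: measurable_funTS.
by move=> x _ /=; rewrite lee_fin [leRHS]ger0_norm ?normal_pdf_ge0.
Qed.

Lemma is_derive_gauss_primitive (x : R) : is_derive x (1 : R) G (kg x).
Proof.
have xu : x < x + 1 by rewrite ltrDl.
have kgx : {for x, continuous kg}.
  apply: cvgM; first exact: k_cont.
  exact: (@continuous_normal_pdf _ 0 1 (oner_neq0 _)).
have [] := @continuous_FTC1 _ kg -oo%O x _ xu (int_kg (measurable_itv _)) _ kgx.
  by rewrite ltNyr.
move=> d1 d2.
by apply: DeriveDef => //; rewrite -derive1E.
Qed.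

Let norm_int_kg (D : set (measurableTypeR R)) : measurable D ->
  `|\int[mu]_(t in D) kg t| <= fine (normal_prob 0 1 D).
Proof.
move=> mD; apply: le_trans (le_normr_Rintegral mD (int_kg mD)) _.
apply: le_Rintegral => //; first exact/integrable_norm/int_kg.
exact: int_gauss.
Qed.

Let G_le_cdf x : `|G x| <= normal_cdf x. Proof. exact: norm_int_kg. Qed.

Let G_le_ccdf x : `|G x| <= 1 - normal_cdf x.
Proof.
have <- : fine (normal_prob 0 1 `]x, +oo[) = 1 - normal_cdf x.
  rewrite -setCitvl probability_setC // fineB //; exact: fin_num_measure.
suff -> : G x = - \int[mu]_(t in `]x, +oo[) kg t.
  by rewrite normrN; exact: norm_int_kg.
apply/eqP; rewrite -addr_eq0 -k_int0 -Rintegral_setU //.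
- by rewrite -setCitvl setUv.
- by apply: int_kg; exact: measurableU.
- by apply/disj_setPS; rewrite -setCitvl setICr.
Qed.

Let is_derive_gaussBG (x : R) :
  is_derive x (1 : R) (gauss - G : R -> R) (- x * gauss x - kg x).
Proof. by apply: is_deriveB; [exact: is_derive_gauss | exact: is_derive_gauss_primitive]. Qed.

(** On both tails [gauss - G] is monotone, and [G] vanishes at infinity. *)
Let G_le_gauss_left x : x <= -1 -> G x <= gauss x.
Proof.
move=> x1; apply/ler_addgt0Pr => e e0.
near (-oo%R : set_system R) => y.
have yx : y <= x by near: y; apply: nbhs_ninfty_le; exact: num_real.
have Py : normal_cdf y < e by near: y; exact: (cvgr_lt _ normal_cdf_Ny).
have [z /andP[yz zx] e1] := le_mvt is_derive_gaussBG yx.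
have : 0 <= (- z * gauss z - kg z) * (x - y).
  apply: mulr_ge0; last by rewrite subr_ge0.
  have := kg_le z; rewrite ler_norml => /andP[_ h].
  have := gauss_gt0 z => h2; nra.
rewrite -e1 /= !fctE; have := gauss_gt0 y; have := G_le_cdf y.
by rewrite ler_norml => /andP[_ ? ?]; lra.
Unshelve. all: by end_near. Qed.

Let G_le_gauss_right x : 1 <= x -> G x <= gauss x.
Proof.
move=> x1; apply/ler_addgt0Pr => e e0.
near (+oo%R : set_system R) => y.
have xy : x <= y by near: y; apply: nbhs_pinfty_ge; exact: num_real.
have Py : 1 - e < normal_cdf y.
  by near: y; apply: (cvgr_gt _ normal_cdf_y); rewrite ltrBlDr ltrDl.
have [z /andP[xz zy] e1] := le_mvt is_derive_gaussBG xy.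
have : (- z * gauss z - kg z) * (y - x) <= 0.
  apply: mulr_le0_ge0; last by rewrite subr_ge0.
  have := kg_le z; rewrite ler_norml => /andP[h _].
  have := gauss_gt0 z => h2; nra.
rewrite -e1 /= !fctE; have := gauss_gt0 y; have := G_le_ccdf y.
by rewrite ler_norml => /andP[_ ? ?]; lra.
Unshelve. all: by end_near. Qed.

Let gauss1 x : -1 <= x <= 1 -> gauss 1 <= gauss x.
Proof.
move=> x1; rewrite !gaussE ler_wpM2l ?normal_peak_ge0 // ler_expR.
by rewrite ler_pM2r ?invr_gt0 // lerN2; case/andP: x1 => ? ?; nra.
Qed.

Let normal_cdf_le1 x : normal_cdf x <= 1.
Proof. by rewrite -lee_fin fineK ?fin_num_measure // probability_le1. Qed.

Lemma gauss_primitive_le x : G x <= (1 + (gauss 1)^-1) * gauss x.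
Proof.
have g0 := gauss_gt0 x; have g1 := gauss_gt0 1.
have gV : 0 < (gauss 1)^-1 by rewrite invr_gt0.
have le : gauss x <= (1 + (gauss 1)^-1) * gauss x.
  by apply: ler_peMl; [exact: ltW | rewrite lerDl; exact: ltW].
(* On the central interval the density is bounded below by [gauss 1]. *)
have [x1|x1] := leP x (-1); first exact: le_trans (G_le_gauss_left x1) le.
have [x2|x2] := leP 1 x; first exact: le_trans (G_le_gauss_right x2) le.
apply: le_trans (ler_norm _) _; apply: le_trans (G_le_cdf x) _.
apply: le_trans (normal_cdf_le1 x) _; rewrite mulrDl mul1r.
have : 1 <= (gauss 1)^-1 * gauss x.
  by rewrite ler_pdivlMl // mulr1; apply: gauss1; rewrite !ltW.
lra.
Qed.

End Bound.

Lemma lipschitz_continuous (h : R -> R) (L : R) :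
  (forall x y, `|h y - h x| <= L * `|y - x|) -> continuous h.
Proof.
move=> hL x; apply/cvgrPdist_le => e e0; near=> y.
apply: le_trans (hL y x) _.
apply: le_trans (_ : (`|L| + 1) * `|x - y| <= _).
  by rewrite ler_wpM2r // (le_trans (ler_norm L)) // lerDl.
rewrite -ler_pdivlMl ?ltr_wpDl //; near: y.
apply/nbhs_ballP; exists ((`|L| + 1)^-1 * e) => [|y]; last exact: ltW.
by rewrite /= mulr_gt0 // invr_gt0 ltr_wpDl.
Unshelve. all: by end_near. Qed.

Lemma integrable_gauss_bounded (h : R -> R) :
  continuous h -> (forall x, `|h x| <= 1) ->
  mu.-integrable setT (EFin \o (fun x => h x * gauss x)).
Proof.
move=> hc h01; apply: le_integrable (integrable_normal_pdf 0 1) => //.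
  apply/measurable_EFinP; apply: measurable_funM.
    exact: continuous_measurable_fun.
  exact: measurable_normal_pdf.
move=> x _ /=; rewrite lee_fin normrM (ger0_norm (normal_pdf_ge0 _ _ _)).
by rewrite ler_piMl ?normal_pdf_ge0.
Qed.

Definition gauss_mean (h : R -> R) : R := \int[mu]_x (h x * gauss x).

Let int_gauss1 : \int[mu]_x gauss x = 1.
Proof. by rewrite /Rintegral integral_normal_pdf. Qed.

(** For a bounded Lipschitz [h] the equation [phi' - x phi = h - E h] has a
    bounded solution, the primitive of [(h - E h) * gauss] divided by [gauss]; its
    regularity then follows from the equation itself. *)
Lemma stein_solution (h : R -> R) (L : R) :
  (forall x y, `|h y - h x| <= L * `|y - x|) ->
  (forall x, 0 <= h x <= 1) ->
  exists phi dphi : R -> R, exists C : R,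
  [/\ forall x y, `|y - x| <= 1 ->
        `|phi y - phi x - dphi x * (y - x)| <= C * (1 + x ^+ 2) * (y - x) ^+ 2,
      forall x, dphi x ^+ 2 <= C * (1 + x ^+ 2) &
      forall x, dphi x - x * phi x = h x - gauss_mean h].
Proof.
move=> hL h01.
have hc := lipschitz_continuous hL.
have h_le1 x : `|h x| <= 1 by case/andP: (h01 x) => h0 ?; rewrite ger0_norm.
have inth := integrable_gauss_bounded hc h_le1.
have intg := integrable_normal_pdf (R := R) 0 1.
set m := gauss_mean h.
have m01 : 0 <= m <= 1.
  apply/andP; split.
    apply: Rintegral_ge0 => x _; rewrite mulr_ge0 ?normal_pdf_ge0 //.
    by case/andP: (h01 x).
  rewrite -int_gauss1; apply: le_Rintegral => // x _.
  by rewrite ler_piMl ?normal_pdf_ge0 //; case/andP: (h01 x).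
pose k x := h x - m.
have k_cont : continuous k by move=> x; apply: cvgB; [exact: hc | exact: cvg_cst].
have k_le1 x : `|k x| <= 1.
  by have := h01 x; rewrite ler_norml /k; move: m01 => /andP[? ?] /andP[? ?]; lra.
have intk := integrable_gauss_bounded k_cont k_le1.
have k_int0 : \int[mu]_x (k x * gauss x) = 0.
  under eq_Rintegral do rewrite mulrBl.
  rewrite RintegralB //; last first.
    by apply: (integrableZl _ m intg).
  by rewrite RintegralZl // int_gauss1 mulr1 subrr.
pose G x := \int[mu]_(t in `]-oo, x]) (k t * gauss t).
pose phi x := G x / gauss x.
pose dphi x := x * phi x + k x.
pose C1 := 1 + (gauss 1)^-1.
have C1_ge1 : 1 <= C1 by rewrite lerDl invr_ge0 normal_pdf_ge0.
have phi_le x : `|phi x| <= C1.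
  have g0 := gauss_gt0 x.
  rewrite ler_norml /phi ler_pdivrMr // ler_pdivlMr // gauss_primitive_le // andbT.
  have kN : \int[mu]_x (- k x * gauss x) = 0.
    under eq_Rintegral do rewrite mulNr -mulN1r.
    by rewrite RintegralZl ?k_int0 ?mulr0.
  have kN_cont : continuous (fun x => - k x).
    by move=> y; apply: (@cvgN _ R^o); exact: k_cont.
  have kN_le1 y : `|- k y| <= 1 by rewrite normrN.
  have := gauss_primitive_le kN_cont kN_le1 kN x.
  under eq_Rintegral do rewrite mulNr -mulN1r.
  rewrite RintegralZl //; last exact: integrableS intk.
  by rewrite -/(G x) mulN1r mulNr lerNl.
have phi_d (x : R) : is_derive x (1 : R) phi (dphi x).
  have gn0 : gauss x != 0 by rewrite gt_eqF ?gauss_gt0.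
  have h1 := is_derive_gauss_primitive k_cont k_le1 x.
  have h2 := is_deriveV gn0 (is_derive_gauss x).
  have := is_deriveM h1 h2.
  have scaleE (a b : R) : a *: b = a * b by [].
  move=> /is_derive_eq; apply; rewrite !scaleE /dphi /phi.
  rewrite -/(G x); by field.
have dphi_le x : `|dphi x| <= C1 * `|x| + 1.
  apply: le_trans (ler_normD _ _) _; apply: lerD => //.
  by rewrite normrM mulrC ler_wpM2r.
have phi_lip x y : `|y - x| <= 1 ->
    `|phi y - phi x| <= (C1 * (`|x| + 1) + 1) * `|y - x|.
  have lip a b : a <= b -> `|b - a| <= 1 -> forall z, `|a - z| <= 1 -> `|b - z| <= 1 ->
      `|phi b - phi a| <= (C1 * (`|z| + 1) + 1) * `|b - a|.
    move=> ab ab1 z az bz; have [t /andP[at_ tb] ->] := le_mvt phi_d ab.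
    rewrite normrM ler_wpM2r //; apply: le_trans (dphi_le t) _.
    rewrite lerD2r ler_wpM2l //; first lra.
    have tz : `|t - z| <= 1 by move: az bz; rewrite !ler_norml => /andP[? ?] /andP[? ?]; lra.
    by rewrite -[t](subrK z) addrC (le_trans (ler_normD _ _)) // lerD2l.
  move=> xy; have [le|/ltW le] := leP x y.
    by apply: lip => //; rewrite subrr normr0.
  by rewrite distrC [X in _ * X]distrC; apply: lip => //; rewrite ?subrr ?normr0 // distrC.
have dphi_lip x y : `|y - x| <= 1 ->
    `|dphi y - dphi x| <= ((C1 * (`|x| + 1) + 1) * (`|x| + 1) + C1 + L) * `|y - x|.
  move=> xy.
  have -> : dphi y - dphi x = y * (phi y - phi x) + ((y - x) * phi x + (h y - h x)).
    by rewrite /dphi /k; ring.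
  rewrite [leRHS]mulrDl [in leRHS]mulrDl -addrA.
  apply: le_trans (ler_normD _ _) _; apply: lerD.
    rewrite normrM mulrC mulrAC; apply: ler_pM => //; first exact: phi_lip.
    by rewrite -[y in leLHS](subrK x) addrC (le_trans (ler_normD _ _)) // lerD2l.
  apply: le_trans (ler_normD _ _) _; apply: lerD => //.
  by rewrite normrM mulrC ler_wpM2r.
have L0 : 0 <= L.
  have := hL 0 1; rewrite subr0 normr1 mulr1; exact: le_trans.
pose C := 5 * C1 ^+ 2 + L + 4.
have quad x : (C1 * (`|x| + 1) + 1) * (`|x| + 1) + C1 + L <= C * (1 + x ^+ 2).
  rewrite -[x ^+ 2]real_normK ?num_real // /C.
  have := normr_ge0 x; set t := `|x| => t0.
  have ts : t <= 1 + t ^+ 2 by nra.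
  have CC : C1 <= C1 ^+ 2 by rewrite expr2 ler_peMl //; lra.
  have s1 : 1 <= 1 + t ^+ 2 by rewrite lerDl sqr_ge0.
  set s := 1 + t ^+ 2 in ts s1 *.
  have -> : (C1 * (t + 1) + 1) * (t + 1) + C1 + L =
            C1 * s + (2 * C1 + 1) * t + (C1 + 1) + L by rewrite /s; ring.
  have Ls : L <= L * s by rewrite ler_peMr.
  have Cs : C1 * s <= C1 ^+ 2 * s by rewrite ler_wpM2r //; lra.
  have Ct : (2 * C1 + 1) * t <= (2 * C1 + 1) * s by rewrite ler_wpM2l //; lra.
  have C1s : C1 + 1 <= (C1 + 1) * s by rewrite ler_peMr //; lra.
  lra.
exists phi, dphi, C; split => [x y xy|x|x].
- have [z zx ->] : exists2 z, `|z - x| <= `|y - x| & phi y - phi x = dphi z * (y - x).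
    have [le|/ltW le] := leP x y.
      have [z /andP[xz zy] ->] := le_mvt phi_d le; exists z => //.
      by rewrite !ger0_norm ?subr_ge0 // lerD2r.
    have [z /andP[xz zy] e] := le_mvt phi_d le; exists z.
      by rewrite !ler0_norm ?subr_le0 // !opprB lerD2l lerN2.
    by rewrite -opprB e; ring.
  rewrite -mulrBl normrM -[(y - x) ^+ 2]real_normK ?num_real // expr2 mulrA.
  rewrite ler_wpM2r //.
  apply: le_trans (dphi_lip _ _ (le_trans zx xy)) _.
  apply: ler_pM => //.
  have C10 : 0 <= C1 by lra.
  by rewrite addr_ge0 // addr_ge0 // mulr_ge0 // ?addr_ge0 // mulr_ge0 // addr_ge0.
- rewrite -[leLHS]real_normK ?num_real // -[x ^+ 2]real_normK ?num_real //.
  apply: le_trans (_ : (C1 * `|x| + 1) ^+ 2 <= _).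
    by rewrite ler_pXn2r ?nnegrE ?addr_ge0 ?mulr_ge0 //; lra.
  have := normr_ge0 x; set t := `|x| => t0; rewrite /C.
  have h1 : 0 <= (C1 * t - 1) ^+ 2 by exact: sqr_ge0.
  have h2 : 0 <= C1 ^+ 2 * t ^+ 2 by rewrite mulr_ge0 ?sqr_ge0.
  have h3 : 0 <= L * t ^+ 2 by rewrite mulr_ge0 ?sqr_ge0.
  have h4 := sqr_ge0 t; have h5 := sqr_ge0 C1.
  lra.
- by rewrite /dphi /k; ring.
Qed.

End Gauss.

(** * Central limit theorem for cluster counts of finite graphs *)

Section Standardize.
Variables (R : realType) (I : finType) (p : R).
Hypothesis p01 : 0 < p < 1.

Local Notation cube := {ffun I -> bool}.
Local Notation Ex := (Ex p).
Local Notation Var := (Var p).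

Definition standardize (f : cube -> R) (w : cube) : R :=
  (f w - Ex f) / Num.sqrt (Var f).

Section One.
Variable f : cube -> R.
Hypothesis Vf : 0 < Var f.
Let s := Num.sqrt (Var f).
Let s0 : 0 < s. Proof. by rewrite sqrtr_gt0. Qed.

Lemma Ex_standardize : Ex (standardize f) = 0.
Proof.
rewrite (@eq_Ex _ _ _ _ (fun w => s^-1 * (f w - Ex f))).
  by rewrite ExZ ExB Ex_cst subrr mulr0.
by move=> w; rewrite mulrC.
Qed.

Lemma Ex_sqr_standardize : Ex (fun w => standardize f w ^+ 2) = 1.
Proof.
rewrite (@eq_Ex _ _ _ _ (fun w => (Var f)^-1 * (f w - Ex f) ^+ 2)).
  by rewrite ExZ mulVf // gt_eqF.
by move=> w; rewrite /standardize exprMn exprVn sqr_sqrtr ?ltW // mulrC.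
Qed.

Lemma dif_standardize i w : dif i (standardize f) w = dif i f w / s.
Proof. by rewrite /dif /standardize; ring. Qed.

Lemma interacting_standardize j :
  interacting (standardize f) j \subset interacting f j.
Proof.
apply/fintype.subsetP => i; rewrite !inE => /existsP[w h]; apply/existsP; exists w.
move: h; rewrite (eq_dif j (dif_standardize i)) {1}/dif -mulrBl.
by apply: contraNneq => e; rewrite -/(dif j _ w) e mul0r.
Qed.

End One.

(** The left-hand side is [2 - 2 c], where [c] is the correlation of [f] and [g],
    and [Var (f - g) = a^2 + b^2 - 2 a b c] is at least [2 a b (1 - c)], where
    [a] and [b] are the standard deviations. *)
Lemma standardize_close (f g : cube -> R) : 0 < Var f -> 0 < Var g ->
  Ex (fun w => (standardize f w - standardize g w) ^+ 2) <=
  Var (fun w => f w - g w) / (Num.sqrt (Var f) * Num.sqrt (Var g)).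
Proof.
move=> Vf Vg; set a := Num.sqrt (Var f); set b := Num.sqrt (Var g).
have a0 : 0 < a by rewrite sqrtr_gt0.
have b0 : 0 < b by rewrite sqrtr_gt0.
pose cov := Ex (fun w => (f w - Ex f) * (g w - Ex g)).
have aa : a ^+ 2 = Var f by rewrite sqr_sqrtr // ltW.
have bb : b ^+ 2 = Var g by rewrite sqr_sqrtr // ltW.
have -> : Var (fun w => f w - g w) = a ^+ 2 + b ^+ 2 - 2 * cov.
  rewrite aa bb /Var /cov -ExZ -ExD -ExB; apply: eq_Ex => w.
  by rewrite ExB; ring.
have -> : Ex (fun w => (standardize f w - standardize g w) ^+ 2) =
          2 - 2 * ((a * b)^-1 * cov).
  transitivity (Ex (fun w => standardize f w ^+ 2 + standardize g w ^+ 2 -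
      2 * ((a * b)^-1 * ((f w - Ex f) * (g w - Ex g))))).
    apply: eq_Ex => w; rewrite /standardize -/a -/b.
    by field; rewrite !gt_eqF.
  by rewrite ExB ExD !Ex_sqr_standardize // !ExZ.
rewrite ler_pdivlMr ?mulr_gt0 // -subr_ge0.
rewrite (_ : _ - _ = (a - b) ^+ 2) ?sqr_ge0 //.
by field; rewrite !gt_eqF.
Qed.

Lemma Ex_lipschitz_le (f g : cube -> R) (h : R -> R) (L eps : R) : 0 < eps ->
  (forall x y, `|h y - h x| <= L * `|y - x|) ->
  `|Ex (fun w => h (f w)) - Ex (fun w => h (g w))| <=
  eps + L ^+ 2 / eps * Ex (fun w => (f w - g w) ^+ 2).
Proof.
move=> e0 hL; rewrite -ExB; apply: le_trans (ler_norm_Ex p01 _) _.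
rewrite -ExZ -[X in X + _](Ex_cst I p) -ExD; apply: le_Ex => // w.
apply: le_trans (hL _ _) _; set d := f w - g w.
rewrite -[d ^+ 2]real_normK ?num_real //.
have h1 : 0 <= (L * `|d| - eps) ^+ 2 / eps by rewrite mulr_ge0 ?sqr_ge0 ?invr_ge0 ?ltW.
have h2 : 0 <= L ^+ 2 / eps * `|d| ^+ 2.
  by rewrite mulr_ge0 ?sqr_ge0 // divr_ge0 ?sqr_ge0 // ltW.
have e : (L * `|d| - eps) ^+ 2 / eps = L ^+ 2 / eps * `|d| ^+ 2 + eps - 2 * (L * `|d|).
  by field; rewrite gt_eqF.
rewrite e in h1; lra.
Qed.

End Standardize.

Section Clt.
Variables (R : realType) (p : R).
Hypothesis p01 : 0 < p < 1.

(** The differences of the standardized function are of the order of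
    [#|I| ^ (- 1 / 2)], so [stein_bound] tends to [eta * C], where [eta] is
    arbitrary. *)
Lemma clt_sparse (h : R -> R) (L B c : R) (M : nat) :
  (forall x y, `|h y - h x| <= L * `|y - x|) ->
  (forall x, 0 <= h x <= 1) -> 0 < B -> 0 < c ->
  forall eps : R, 0 < eps -> exists m0 : nat,
  forall (I : finType) (f : {ffun I -> bool} -> R), (m0 <= #|I|)%N ->
    (forall i w, `|dif i f w| <= B) ->
    (forall j, (#|interacting f j| <= M)%N) ->
    c * #|I|%:R <= Var p f ->
    `|Ex p (fun w => h (standardize p f w)) - gauss_mean h| <= eps.
Proof.
move=> hL h01 B0 c0 eps eps0.
have [phi [dphi [C [phiT dphiC eqn]]]] := stein_solution hL h01.
have C0 : 0 <= C.
  by have := dphiC 0; rewrite expr0n addr0 mulr1; apply: le_trans; exact: sqr_ge0.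
pose eta := eps / (2 * (C + 1)).
have eta0 : 0 < eta by rewrite divr_gt0 // mulr_gt0 // ltr_wpDl.
pose Q := B ^+ 2 / c * (2 * C + 2 * M%:R ^+ 2 / eta).
have Q0 : 0 <= Q.
  apply: mulr_ge0; first by rewrite divr_ge0 ?sqr_ge0 // ltW.
  apply: addr_ge0; first by rewrite mulr_ge0.
  by rewrite divr_ge0 ?(ltW eta0) // mulr_ge0 ?sqr_ge0.
pose beta := Num.min 1 (eps / (2 * (Q + 1))).
have beta0 : 0 < beta by rewrite lt_min ltr01 divr_gt0 // mulr_gt0 // ltr_wpDl.
exists (Num.bound (B ^+ 2 / (c * beta ^+ 2))) => I f mI difB inter Vf.
have I0 : B ^+ 2 / (c * beta ^+ 2) < #|I|%:R.
  apply: lt_le_trans (archi_boundP _) _; last by rewrite ler_nat.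
  by rewrite divr_ge0 ?sqr_ge0 // mulr_ge0 ?sqr_ge0 // ltW.
have cb0 : 0 < c * beta ^+ 2 by rewrite mulr_gt0 // exprn_gt0.
have Ipos : 0 < #|I|%:R :> R.
  by apply: le_lt_trans I0; rewrite divr_ge0 ?sqr_ge0 // ltW.
have cI : 0 < c * #|I|%:R by rewrite mulr_gt0.
have V0 : 0 < Var p f by exact: lt_le_trans Vf.
pose s := Num.sqrt (Var p f).
have s0 : 0 < s by rewrite sqrtr_gt0.
have ss : s ^+ 2 = Var p f by rewrite sqr_sqrtr // ltW.
pose b := B / s.
have b0 : 0 <= b by rewrite divr_ge0 ?ltW.
have bI : #|I|%:R * b ^+ 2 <= B ^+ 2 / c.
  rewrite /b exprMn exprVn ss mulrA ler_pdivrMr // mulrAC ler_pdivlMr //.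
  rewrite -mulrA [leRHS]mulrC mulrCA [leRHS]mulrC ler_wpM2l ?sqr_ge0 //.
  by rewrite mulrC.
have bbeta : b <= beta.
  rewrite -(ler_pXn2r (n := 2)) ?nnegrE ?(ltW beta0) // -(ler_pM2l Ipos).
  apply: le_trans bI _; move: I0; rewrite ltr_pdivrMr // => /ltW I0.
  by rewrite ler_pdivrMr // -mulrA [X in _ * X]mulrC.
have b1 : b <= 1 by apply: le_trans bbeta _; rewrite ge_min lexx.
have bQ : b * Q <= eps / 2.
  apply: le_trans (_ : eps / (2 * (Q + 1)) * (Q + 1) <= _).
    apply: ler_pM => //; last by rewrite lerDl.
    by apply: le_trans bbeta _; rewrite ge_min lexx orbT.
  rewrite le_eqVlt; apply/orP; left; apply/eqP; field.
  by rewrite gt_eqF // ltr_wpDl.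
have dle i w : `|dif i (standardize p f) w| <= b.
  have sV : 0 <= s^-1 by rewrite invr_ge0 ltW.
  by rewrite dif_standardize normrM (ger0_norm sV) ler_wpM2r.
have ile j : (#|interacting (standardize p f) j| <= M)%N.
  by apply: leq_trans (inter j); exact/subset_leq_card/interacting_standardize.
have := stein_bound p01 dle ile b0 b1 (Ex_standardize p f) (Ex_sqr_standardize V0)
  phiT dphiC eta0.
set F := standardize p f.
have -> : Ex p (fun w => F w * phi (F w)) - Ex p (fun w => dphi (F w)) =
          - (Ex p (fun w => h (F w)) - gauss_mean h).
  rewrite -[gauss_mean h](Ex_cst I p) -!ExB -ExN; apply: eq_Ex => w.
  by rewrite -eqn; ring.
rewrite normrN => /le_trans; apply.
have e1 : eta * C <= eps / 2.
  rewrite /eta mulrAC ler_pdivrMr ?mulr_gt0 ?ltr_wpDl //.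
  have -> : eps / 2 * (2 * (C + 1)) = eps * C + eps by field.
  by rewrite lerDl ltW.
have e2 : 2 * C * #|I|%:R * b ^+ 3 + 2 * #|I|%:R * M%:R ^+ 2 * b ^+ 4 / eta <= b * Q.
  have -> : 2 * C * #|I|%:R * b ^+ 3 + 2 * #|I|%:R * M%:R ^+ 2 * b ^+ 4 / eta =
    b * (#|I|%:R * b ^+ 2 * (2 * C + b * (2 * M%:R ^+ 2 / eta))) by ring.
  have tM : 0 <= 2 * M%:R ^+ 2 / eta.
    by rewrite divr_ge0 ?(ltW eta0) // mulr_ge0 ?sqr_ge0.
  rewrite ler_wpM2l //; apply: ler_pM => //.
  - by rewrite mulr_ge0 ?sqr_ge0.
  - by rewrite addr_ge0 // mulr_ge0.
  - by rewrite lerD2l ler_piMl.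
lra.
Qed.

Definition kappa_all (s : nat) : R := s%:R^-1.
Definition kappa_small (n s : nat) : R := Num.max (s%:R^-1 - n%:R^-1) 0.
Definition kappa_large (n s : nat) : R := Num.min s%:R^-1 n%:R^-1.

Lemma kappa_split n s : kappa_all s - kappa_small n s = kappa_large n s.
Proof.
rewrite /kappa_all /kappa_small /kappa_large.
case: (leP (s%:R^-1 - n%:R^-1) 0) => h; case: (leP s%:R^-1 n%:R^-1) => h2 //; lra.
Qed.

Lemma invn_mono s t : (0 < s)%N -> (s <= t)%N -> t%:R^-1 <= s%:R^-1 :> R.
Proof.
by move=> s0 st; rewrite lef_pV2 ?posrE ?ltr0n ?ler_nat // (leq_trans s0).
Qed.

Lemma kappa_small_ge0 n s : 0 <= kappa_small n s.
Proof. by rewrite le_max lexx orbT. Qed.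

Lemma kappa_small_le n s : kappa_small n s <= s%:R^-1.
Proof. by rewrite ge_max invr_ge0 ler0n andbT lerBlDr lerDl invr_ge0. Qed.

Lemma kappa_small_mono n s t :
  (0 < s)%N -> (s <= t)%N -> kappa_small n t <= kappa_small n s.
Proof.
move=> s0 st; rewrite ge_max kappa_small_ge0 andbT le_max lerD2r.
by rewrite invn_mono.
Qed.

Lemma kappa_small0 n s : (0 < n)%N -> (n <= s)%N -> kappa_small n s = 0.
Proof. by move=> n0 ns; apply/max_idPr; rewrite subr_le0 invn_mono. Qed.

Lemma kappa_large_ge0 n s : 0 <= kappa_large n s.
Proof. by rewrite le_min !invr_ge0 !ler0n. Qed.

Lemma kappa_large_le n s : kappa_large n s <= s%:R^-1.
Proof. by rewrite ge_min lexx. Qed.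

Lemma kappa_large_len n s : kappa_large n s <= n%:R^-1.
Proof. by rewrite ge_min lexx orbT. Qed.

Lemma kappa_large_mono n s t :
  (0 < s)%N -> (s <= t)%N -> kappa_large n t <= kappa_large n s.
Proof. by move=> s0 st; rewrite le_min !ge_min lexx invn_mono ?orbT. Qed.

Lemma kappa_all12 : 2^-1 <= kappa_all 1 - kappa_all 2.
Proof. by rewrite /kappa_all; lra. Qed.

Lemma kappa_small12 n : (1 < n)%N -> 2^-1 <= kappa_small n 1 - kappa_small n 2.
Proof.
move=> n1; rewrite /kappa_small.
have h1 := invn_mono (isT : 0 < 1)%N (ltnW n1).
have h2 := invn_mono (isT : 0 < 2)%N n1.
by rewrite !max_l ?subr_ge0 // invr1; lra.
Qed.

(** Small clusters give a local function, to which [clt_sparse] applies; large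
    clusters contribute a negligible part of the variance. *)
Lemma clt_cluster_sum (h : R -> R) (L : R) (D : nat) :
  (forall x y, `|h y - h x| <= L * `|y - x|) ->
  (forall x, 0 <= h x <= 1) ->
  forall eps : R, 0 < eps -> exists m0 : nat,
  forall (T I : finType) (inc : I -> {set T}),
    (forall i, #|inc i| = 2%N) ->
    (forall x, (#|[set i | x \in inc i]%SET| <= D)%N) ->
    (#|T| <= 2 * #|I|)%N -> (m0 <= #|I|)%N ->
    0 < Var p (cluster_sum inc kappa_all) /\
    `|Ex p (fun w => h (standardize p (cluster_sum inc kappa_all) w)) -
      gauss_mean h| <= eps.
Proof.
move=> hL h01 eps eps0.
have /andP[p_gt0 p_lt1] := p01.
pose c := p * (1 - p) * (2^-1 * (1 - p) ^+ D) ^+ 2.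
have c0 : 0 < c.
  by rewrite !mulr_gt0 ?exprn_gt0 ?mulr_gt0 ?exprn_gt0 ?subr_gt0 ?invr_gt0.
(* Admissible variance per edge of the large clusters: after division by [c] it
   costs at most [eps / 4] in [Ex_lipschitz_le]. *)
pose e1 := c * eps ^+ 2 / (16 * (L ^+ 2 + 1)).
have L1 : 0 < L ^+ 2 + 1 by rewrite ltr_wpDl ?sqr_ge0.
have e1_gt0 : 0 < e1.
  by apply: divr_gt0; apply: mulr_gt0 => //; exact: exprn_gt0.
(* The two terms of [Var_cluster_sum_le]: [lam] controls the first, then [n] the
   second. *)
pose lam := Num.min 2^-1 (e1 / (16 * (D%:R + 1))).
have D1 : 0 < D%:R + 1 :> R by rewrite ltr_wpDl.
have lam0 : 0 < lam by rewrite lt_min invr_gt0 ltr0n /=; apply: divr_gt0 => //; exact: mulr_gt0.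
have lam2 : 0 < lam <= 2^-1 by rewrite lam0 ge_min lexx.
pose n := (Num.bound (8 / (lam * e1))).+2.
have nn : 8 / (lam * e1) <= n%:R.
  apply/ltW/(lt_le_trans (archi_boundP _)); last by rewrite ler_nat; exact: leqW (leqnSn _).
  by rewrite divr_ge0 // mulr_ge0 ?ltW.
have small : 4 * (2 * lam * D%:R + (lam * n%:R)^-1) <= e1.
  have h1 : lam * D%:R <= e1 / 16.
    apply: le_trans (_ : e1 / (16 * (D%:R + 1)) * (D%:R + 1) <= _).
      by apply: ler_pM => //; [exact: ltW | rewrite ge_min lexx orbT | rewrite lerDl].
    by rewrite le_eqVlt; apply/orP; left; apply/eqP; field; rewrite gt_eqF.
  have n0 : 0 < n%:R :> R by rewrite ltr0n.
  have h2 : (lam * n%:R)^-1 <= e1 / 8.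
    have e8 : 0 < e1 / 8 by exact: divr_gt0.
    have ln0 : 0 < lam * n%:R by exact: mulr_gt0.
    rewrite -[leRHS]invrK lef_pV2 ?posrE ?invr_gt0 //.
    rewrite invf_div -ler_pdivrMl //.
    by apply: le_trans nn; rewrite le_eqVlt; apply/orP; left; apply/eqP; field; rewrite !gt_eqF.
  move: h1 h2; rewrite -mulrA; set X := lam * D%:R; set Y := (lam * n%:R)^-1; lra.
pose M := (2 * (2 * D + 1) ^ n * (D * (2 * D + 1) ^ n))%N.
have [m0 clt] := clt_sparse M hL h01 (ltr0n R 2) c0 (divr_gt0 eps0 (ltr0n R 2)).
exists m0.+1 => T I inc inc2 deg TI mI.
have Ipos : 0 < #|I|%:R :> R by rewrite ltr0n (leq_trans _ mI).
set K := cluster_sum inc kappa_all.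
pose f := cluster_sum inc (kappa_small n).
have VK : c * #|I|%:R <= Var p K.
  by apply: (Var_cluster_sum_ge p01 inc2 deg invn_mono); exact: kappa_all12.
have Vf : c * #|I|%:R <= Var p f.
  by apply: (Var_cluster_sum_ge p01 inc2 deg (@kappa_small_mono n)); exact: kappa_small12.
have cI : 0 < c * #|I|%:R by rewrite mulr_gt0.
have VK0 := lt_le_trans cI VK; have Vf0 := lt_le_trans cI Vf.
split=> //.
have VN : Var p (fun w => K w - f w) <= e1 * #|I|%:R.
  have -> : Var p (fun w => K w - f w) = Var p (cluster_sum inc (kappa_large n)).
    have e w : K w - f w = cluster_sum inc (kappa_large n) w.
      by rewrite /K /f /cluster_sum -sumrB; apply: eq_bigr => v _; rewrite kappa_split.
    by rewrite /Var (eq_Ex p e); apply: eq_Ex => w; rewrite e.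
  apply: le_trans (Var_cluster_sum_le p01 inc2 deg (@kappa_large_ge0 n)
    (fun s _ => kappa_large_le n s) (@kappa_large_mono n) (isT : 0 < n)%N lam2
    (@kappa_large_len n)) _.
  apply: le_trans (ler_wpM2r (ltW Ipos) small).
  rewrite [leRHS]mulrAC; apply: ler_wpM2r.
    apply: addr_ge0; last by rewrite invr_ge0 mulr_ge0 // ltW.
    by rewrite mulr_ge0 // mulr_ge0 // ltW.
  have : #|T|%:R <= 2 * #|I|%:R :> R by rewrite -natrM ler_nat.
  lra.
have close : Ex p (fun w => (standardize p K w - standardize p f w) ^+ 2) <= e1 / c.
  apply: le_trans (standardize_close VK0 Vf0) _.
  rewrite ler_pdivrMr ?mulr_gt0 ?sqrtr_gt0 //; apply: le_trans VN _.
  rewrite -(mulrA e1); apply: ler_wpM2l; first exact: ltW.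
  rewrite ler_pdivlMl // -[leLHS]sqr_sqrtr ?(ltW cI) // expr2.
  by apply: ler_pM; rewrite ?sqrtr_ge0 // ler_sqrt ?(ltW VK0) ?(ltW Vf0).
have fclt : `|Ex p (fun w => h (standardize p f w)) - gauss_mean h| <= eps / 2.
  apply: clt => //; first exact: ltnW.
  - move=> i w; apply: (norm_dif_cluster_sum inc2) => //.
    + exact: kappa_small_ge0.
    + by move=> s _; exact: kappa_small_le.
    + exact: kappa_small_mono.
  - apply: (card_interacting inc2 deg) => //.
    by move=> s; exact: kappa_small0.
have e4 : 0 < eps / 4 by rewrite divr_gt0.
have := Ex_lipschitz_le p01 (standardize p K) (standardize p f) e4 hL.
have : L ^+ 2 / (eps / 4) * Ex p (fun w => (standardize p K w - standardize p f w) ^+ 2) <= eps / 4.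
  apply: le_trans (ler_wpM2l _ close) _.
    by rewrite divr_ge0 ?sqr_ge0 ?ltW.
  have -> : L ^+ 2 / (eps / 4) * (e1 / c) = eps / 4 * (L ^+ 2 / (L ^+ 2 + 1)).
    by rewrite /e1; field; rewrite !gt_eqF.
  by rewrite ler_piMr ?(ltW e4) // ler_pdivrMr // mul1r lerDl.
move: fclt; rewrite !ler_norml => /andP[? ?] ? /andP[? ?]; apply/andP; split; lra.
Qed.

End Clt.

(** * Percolation observables that depend on finitely many edges *)

Section Restriction.
Variables (V : choiceType) (adj : rel V) (R : realType).
Variables (P : probability (config adj) R) (p : R).
Hypothesis bern : bernoulli_percolation P p.
Variable F : {fset edge adj}.

Definition restrict_cfg (w : config adj) : {ffun F -> bool} := [ffun e => w (val e)].

Let fiber (g : {ffun F -> bool}) : set (config adj) := [set w | restrict_cfg w = g].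

Let fiberE g : fiber g = \bigcap_(e in [set` F])
  [set w | [set b | b = oapp g true (insub e)] (w e)].
Proof.
apply/seteqP; split => [w <- e /= eF|w h] /=.
  by rewrite insubT /= ffunE.
apply/ffunP => e; rewrite ffunE; have := h (val e) (valP e) => /= ->.
by rewrite valK.
Qed.

Let measurable_fiber g : measurable (fiber g).
Proof.
rewrite fiberE; apply: fin_bigcap_measurable; first exact: finite_fset.
by move=> e _; exact: measurable_coord.
Qed.

Let prob_fiber g : P (fiber g) = (weight p g)%:E.
Proof.
have [ind marg] := bern.
rewrite fiberE (ind F (fun e => [set b | b = oapp g true (insub e)])).
rewrite big_seq_fsetE /= /weight -prodEFin; apply: eq_bigr => e _.
rewrite valK /=; case: (g e) => /=; first exact: marg.
have -> : [set w : config adj | w (val e) = false] =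
          ~` [set w | w (val e) = true].
  by apply/seteqP; split => w /=; case: (w (val e)).
rewrite probability_setC ?marg //.
exact: (measurable_coord (val e) [set b | b = true]).
Qed.

(** By independence the restricted configuration has the law [weight p]. *)
Lemma expectation_restrict (phi : {ffun F -> bool} -> R) :
  ('E_P[fun w => phi (restrict_cfg w)])%E = (Ex p phi)%:E.
Proof.
rewrite unlock.
have e w : (phi (restrict_cfg w))%:E =
    (\sum_(g : {ffun F -> bool}) (phi g)%:E * (\1_(fiber g) w)%:E)%E.
  rewrite (bigD1 (restrict_cfg w)) //= indicE mem_set // mule1 big1 ?adde0 // => g gw.
  rewrite indicE memNset ?mule0 // /fiber /= => h.
  by rewrite h eqxx in gw.
rewrite (eq_integral _ _ (fun w _ => e w)) integral_sum //; last first.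
  by move=> g; apply: integrableZl => //; exact: integrable_indic.
rewrite /Ex -sumEFin; apply: eq_bigr => g _.
rewrite integralZl //; last exact: integrable_indic.
rewrite integral_indic // setIT mulrC EFinM; congr (_ * _)%E; exact: prob_fiber.
Qed.

Lemma variance_restrict (phi : {ffun F -> bool} -> R) :
  ('V_P[fun w => phi (restrict_cfg w)])%E = (Var p phi)%:E.
Proof.
rewrite /variance unlock expectation_restrict /=.
by rewrite -(expectation_restrict (fun w => (phi w - Ex p phi) ^+ 2)).
Qed.

Lemma prob_restrict_le (phi : {ffun F -> bool} -> R) (x : R) :
  P [set w | phi (restrict_cfg w) <= x] = (Ex p (fun g => (phi g <= x)%R%:R))%:E.
Proof.
have mA : measurable [set w | phi (restrict_cfg w) <= x].
  rewrite (_ : mkset _ = \bigcup_(g in [set g | phi g <= x]) fiber g).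
    by apply: fin_bigcup_measurable => [|g _]; [exact: finite_finset | exact: measurable_fiber].
  apply/seteqP; split => [w /= h|w [g /= h gw]]; last by rewrite /= gw.
  by exists (restrict_cfg w).
rewrite -expectation_indic // -expectation_restrict; congr ('E_P[_])%E.
apply/funext => w; rewrite indicE.
by case: (boolP (phi _ <= x)) => h; [rewrite mem_set | rewrite memNset //; exact/negP].
Qed.

End Restriction.

(** * Balls of the infinite graph as finite graphs *)

(** The reciprocal sizes add up to one over each component. *)
Lemma n_comp_sum (R : realType) (T : finType) (e : rel T) : connect_sym e ->
  (n_comp e predT)%:R = \sum_v (#|[pred u | connect e v u]|%:R)^-1 :> R.
Proof.
move=> es; rewrite (partition_big (fingraph.root e) (mem (roots e))) /=; last first.
  by move=> v _; exact: roots_root.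
rewrite /n_comp_mem -sum1_card natr_sum (eq_bigl (mem (roots e))); last first.
  by move=> r; rewrite !inE andbT.
apply: eq_bigr => r rr.
have cE v : (fingraph.root e v == r) = connect e r v.
  by rewrite -[in LHS](eqP rr) (root_connect es) es.
under eq_bigl do rewrite cE.
rewrite (eq_bigr (fun=> (#|[pred u | connect e r u]|%:R)^-1)); last first.
  move=> v rv; congr (_%:R^-1); apply: eq_card => u; rewrite !inE.
  by rewrite (same_connect es rv).
rewrite sumr_const -[RHS]mulr_natr.
have -> : #|(fun v => connect e r v)| = #|[pred u | connect e r u]|.
  by apply: eq_card => u; rewrite inE.
rewrite mulVf // pnatr_eq0 -lt0n; apply/card_gt0P; exists r.
by rewrite inE connect0.
Qed.

Section FiniteSubgraph.
Variables (V : choiceType) (adj : rel V) (A : {fset V}).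
Hypothesis sg : simple_graph adj.

Let adj_sym : symmetric adj. Proof. by case: sg. Qed.
Let adj_irr : irreflexive adj. Proof. by case: sg. Qed.

Definition edges_in : {fset edge adj} :=
  fset_set [set e : edge adj | (val e `<=` A)%fset].

Lemma mem_edges_in (e : edge adj) : (e \in edges_in) = (val e `<=` A)%fset.
Proof.
have fin : finite_set [set e : edge adj | (val e `<=` A)%fset].
  apply: (@sub_finite_set _ _ (val @^-1` [set` fpowerset A])).
    by move=> f /=; rewrite fpowersetE.
  apply: finite_preimage; last exact: finite_fset.
  by move=> x y _ _; exact: val_inj.
by apply/idP/idP => [|h]; rewrite in_fset_set ?inE.
Qed.

Definition ends (i : edges_in) : {set A} := [set x | val x \in val (val i)]%SET.

Lemma edge_ends (e : edge adj) :
  exists x y, [/\ adj x y, x != y & val e = [fset x; y]%fset].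
Proof.
have /asboolP[x [y [xy ->]]] := valP e; exists x, y; split=> //.
by apply: contraTneq xy => ->; rewrite adj_irr.
Qed.

Lemma ends_pair (i : edges_in) : exists x y : A,
  [/\ adj (val x) (val y), x != y, ends i = [set x; y]%SET &
      val (val i) = [fset val x; val y]%fset].
Proof.
have [x [y [xy ne e]]] := edge_ends (val i).
have := valP i; rewrite mem_edges_in e => /fsubsetP sA.
have xA : x \in A by rewrite sA // !inE eqxx.
have yA : y \in A by rewrite sA // !inE eqxx orbT.
exists [` xA]%fset, [` yA]%fset; split=> //.
apply/setP => z; rewrite !inE e !inE.
by rewrite -(inj_eq val_inj) -(inj_eq val_inj z).
Qed.

Lemma card_ends i : #|ends i| = 2%N.
Proof. by have [x [y [_ xy -> _]]] := ends_pair i; rewrite cards2 xy. Qed.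

Lemma ends_edge (x y : A) : adj (val x) (val y) ->
  exists2 i : edges_in, ends i = [set x; y]%SET & val (val i) = [fset val x; val y]%fset.
Proof.
move=> xy.
have He : `[< exists a b, adj a b /\ [fset val x; val y]%fset = [fset a; b]%fset >].
  by apply/asboolP; exists (val x), (val y).
pose e : edge adj := exist _ [fset val x; val y]%fset He.
have eA : e \in edges_in.
  rewrite mem_edges_in; apply/fsubsetP => z; rewrite !inE.
  by move=> /orP[] /eqP ->; exact: valP.
exists [` eA]%fset => //.
by apply/setP => z; rewrite !inE /= ?inE !(inj_eq val_inj).
Qed.

(** Count the pairs of an edge and one of its ends in two ways. *)
Lemma card_vertices_le : (forall x : A, exists y : A, adj (val x) (val y)) ->
  (#|{: A}| <= 2 * #|{: edges_in}|)%N.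
Proof.
move=> nbr.
have -> : (2 * #|{: edges_in}| = \sum_(i : edges_in) #|ends i|)%N.
  by rewrite (eq_bigr (fun=> 2%N)) ?sum_nat_const 1?mulnC // => i _; exact: card_ends.
rewrite (eq_bigr (fun i => \sum_(x in ends i) 1)%N); last by move=> i _; rewrite sum1_card.
rewrite (exchange_big_dep predT) //= -sum1_card; apply: leq_sum => x _.
have [y /ends_edge[i ei _]] := nbr x.
by rewrite (bigD1 i) //= ei !inE eqxx.
Qed.

Lemma card_edges_at (D : nat) (x : A) :
  (#|` fset_set [set y | adj (val x) y]| <= D)%N ->
  finite_set [set y | adj (val x) y] ->
  (#|[set i | x \in ends i]%SET| <= D)%N.
Proof.
move=> cD fin; apply: leq_trans cD.
pose N := fset_set [set y | adj (val x) y].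
have step (i : edges_in) : x \in ends i ->
    exists2 y, adj (val x) y & val (val i) = [fset val x; y]%fset.
  have [a [b [ab _ -> ->]]] := ends_pair i; rewrite !inE => /orP[] /eqP ->.
    by exists (val b).
  by exists (val a); rewrite 1?adj_sym // fsetUC.
have h : {subset [seq val (val i) | i in [set i | x \in ends i]%SET] <=
    [seq [fset val x; y]%fset | y <- N]}.
  move=> e /mapP[i]; rewrite mem_enum inE => /step[y xy ->] ->.
  by apply/mapP; exists y => //; rewrite in_fset_set // inE.
have := uniq_leq_size _ h; rewrite !size_map -cardE; apply.
by rewrite map_inj_in_uniq ?enum_uniq // => i j _ _ /val_inj/val_inj.
Qed.

Lemma connect_open (w : config adj) :
  connect (open_subgraph w (A := A)) =2 connect (orel ends (restrict_cfg edges_in w)).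
Proof.
have os x y : open_subgraph w x y -> orel ends (restrict_cfg edges_in w) x y.
  rewrite /open_subgraph /= /is_open; case: insubP => [e _ ee|_] //= we.
  have eA : e \in edges_in.
    rewrite mem_edges_in ee; apply/fsubsetP => z; rewrite !inE.
    by move=> /orP[] /eqP ->; exact: valP.
  apply/orelP; exists [` eA]%fset.
  by rewrite ffunE /= !inE /= ee !inE !eqxx orbT.
have so x y : orel ends (restrict_cfg edges_in w) x y -> connect (open_subgraph w (A := A)) x y.
  case/orelP => i [wi xi yi].
  have [->|xy] := eqVneq x y; first exact: connect0.
  apply: connect1; rewrite /open_subgraph /= /is_open.
  have -> : [fset val x; val y]%fset = val (val i).
    have [a [b [_ _ e ->]]] := ends_pair i; move: xi yi; rewrite e !inE.
    by do 2![move=> /orP[] /eqP ?]; subst x y; rewrite ?eqxx in xy *; rewrite // fsetUC.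
  by rewrite valK /=; rewrite ffunE in wi.
move=> x y; apply/idP/idP; apply: connect_sub => {}x {}y.
  by move=> /os; exact: connect1.
exact: so.
Qed.

Lemma ncomponents_cluster_sum (R : realType) (w : config adj) :
  (ncomponents w A)%:R =
  cluster_sum ends (@kappa_all R) (restrict_cfg edges_in w) :> R.
Proof.
have os := sym_connect_sym (orel_sym ends (restrict_cfg edges_in w)).
rewrite /ncomponents (eq_n_comp (connect_open w)) n_comp_sum //.
by apply: eq_bigr => v _; rewrite /kappa_all /cluster cardsE.
Qed.

End FiniteSubgraph.

Section Balls.
Variables (V : choiceType) (adj : rel V) (o : V).
Hypothesis sg : simple_graph adj.
Hypothesis conn : connected_graph adj.
Hypothesis lf : locally_finite adj.

Lemma gballP v r w : gball adj v r w <-> exists2 n, (n <= r)%N & walk adj v w n.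
Proof.
rewrite /gball /= /gdist; case: pselect => [ex|ne]; last first.
  by case: ne; have [n h] := conn v w; exists n; exact/asboolP.
case: ex_minnP => m /asboolP wm mmin; split => [mr|[n nr wn]]; first by exists m.
by apply: leq_trans nr; apply: mmin; exact/asboolP.
Qed.

Lemma finite_gball v r : finite_set (gball adj v r).
Proof.
have fin n : finite_set [set w | walk adj v w n].
  elim: n => [|n IH].
    apply: (sub_finite_set _ (finite_set1 v)) => w [s [_ <- /size0nil ->]] //.
  have := bigcup_finite IH (fun x _ => lf x); apply: sub_finite_set.
  move=> w [s [sp sl]]; case/lastP: s sp sl => // s y.
  rewrite rcons_path last_rcons size_rcons => /andP[sp sy] <- [sn].
  by exists (last v s) => //; exists s.
have := bigcup_finite (finite_II r.+1) (fun n _ => fin n); apply: sub_finite_set.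
by move=> w /gballP[n nr wn]; exists n.
Qed.

Definition Ball r : {fset V} := fset_set (gball adj o r).

Lemma mem_Ball r w : (w \in Ball r) = `[< gball adj o r w >].
Proof. by rewrite in_fset_set ?inE //; exact: finite_gball. Qed.

Hypothesis inf : infinite_set [set: V].

Lemma Ball_neighbor r (x : Ball r) : (0 < r)%N -> exists y : Ball r, adj (val x) (val y).
Proof.
move=> r0; have [adj_sym _] := sg.
suff [y yB xy] : exists2 y, gball adj o r y & adj (val x) y.
  have yB' : y \in Ball r by rewrite mem_Ball; exact/asboolP.
  by exists [` yB']%fset.
have [xo|xo] := eqVneq (val x) o.
  have [B _ B2] := infinite_set_fset 2 inf.
  have [z zo] : exists z, z != o.
    apply: contrapT => h; have : (B `<=` [fset o])%fset.
      apply/fsubsetP => z _; rewrite inE; apply/negP => zo.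
      by apply: h; exists z; exact/negP.
    by move/fsubset_leq_card; rewrite cardfs1 leqNgt B2.
  have [n [s [sp sl _]]] := conn o z.
  case: s sp sl => [_ oz|y s /= /andP[oy _] _]; first by rewrite -oz eqxx in zo.
  exists y; last by rewrite xo.
  by apply/gballP; exists 1%N => //; exists [:: y]; rewrite /= oy.
have := valP x; rewrite mem_Ball => /asboolP/gballP[n nr [s [sp sl sn]]].
case/lastP: s sp sl sn => [_ ox _|s y]; first by rewrite -ox eqxx in xo.
rewrite rcons_path last_rcons size_rcons => /andP[sp sy] yx sn.
exists (last o s); last by rewrite adj_sym -yx.
apply/gballP; exists (size s); last by exists s.
by apply: leq_trans nr; rewrite -sn.
Qed.

Lemma card_Ball_unbounded m : exists r0, forall r, (r0 <= r)%N -> (m <= #|` Ball r|)%N.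
Proof.
have [B _ Bm] := infinite_set_fset m inf.
exists (\max_(x <- B) gdist adj o x) => r Br.
apply: leq_trans Bm _; apply: fsubset_leq_card; apply/fsubsetP => x xB.
rewrite mem_Ball; apply/asboolP; apply: leq_trans Br.
exact: (@leq_bigmax_seq _ _ xpredT (gdist adj o)).
Qed.

End Balls.

(** Automorphisms preserve degrees, so finitely many orbits leave finitely many
    degrees. *)
Lemma bounded_degree (V : choiceType) (adj : rel V) :
  locally_finite adj -> quasi_transitive adj ->
  exists D, forall v, (#|` fset_set [set w | adj v w]| <= D)%N.
Proof.
move=> lf qt; pose deg v := #|` fset_set [set w | adj v w]|.
have degE u v : aut_orbit adj u = aut_orbit adj v -> deg u = deg v.
  move=> uv.
  have : aut_orbit adj v v.
    by exists id => //; split=> //; exists id.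
  rewrite -uv => -[f [fb fadj] fu].
  apply/eqP; rewrite /deg -fu; apply/eqP.
  have [g fK gK] := fb.
  have -> : [set w | adj (f u) w] = f @` [set w | adj u w].
    apply/seteqP; split => [w /= uw|_ [w /= uw <-] /=]; last by rewrite fadj.
    by exists (g w); rewrite ?gK //= -fadj gK.
  by rewrite (fset_set_image f (lf u)) card_imfset //=; exact: can_inj fK.
pose orbit_deg (S : set V) : nat :=
  if pselect (exists v, aut_orbit adj v = S) is left h then deg (projT1 (cid h)) else 0%N.
have orbit_degE v : orbit_deg (aut_orbit adj v) = deg v.
  rewrite /orbit_deg; case: pselect => [h|[]]; last by exists v.
  by apply: degE; case: (cid h).
have fin : finite_set (range deg).
  have := finite_image orbit_deg qt; apply: sub_finite_set => _ [v _ <-].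
  by exists (aut_orbit adj v); [exists v | exact: orbit_degE].
exists (\max_(d <- fset_set (range deg)) d) => v.
apply: (@leq_bigmax_seq _ _ xpredT id) => //.
by rewrite in_fset_set // inE; exists v.
Qed.

(** * From smooth test functions to distribution functions *)

Section Ramp.
Variable R : realType.
Implicit Types a d t : R.
Local Notation mu := (@lebesgue_measure R).

Definition ramp a d t : R := Num.min 1 (Num.max 0 ((a + d - t) / d)).

Lemma ramp01 a d t : 0 <= ramp a d t <= 1.
Proof. by rewrite le_min ler01 le_max lexx /= ge_min lexx. Qed.

Lemma ramp_lipschitz a d : 0 < d ->
  forall x y, `|ramp a d y - ramp a d x| <= d^-1 * `|y - x|.
Proof.
move=> d0 x y.
have -> : d^-1 * `|y - x| = `|(a + d - y) / d - (a + d - x) / d|.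
  have -> : (a + d - y) / d - (a + d - x) / d = d^-1 * (x - y) by ring.
  by rewrite normrM gtr0_norm ?invr_gt0 // distrC.
rewrite /ramp; set u := _ / d; set v := (a + d - x) / d.
rewrite real_ler_norml ?num_real //.
have := ler_norm (u - v); have := ler_norm (v - u); rewrite distrC.
set D := `|u - v| => h1 h2.
have D0 : 0 <= D by exact: normr_ge0.
have clampE (z : R) : Num.min 1 (Num.max 0 z) =
    if z < 0 then 0 else if 1 < z then 1 else z.
  by case: (ltP z 0) => z0; [rewrite min_r | case: (ltP 1 z)].
rewrite !clampE; apply/andP; split; case: (ltP u 0) => hu; case: (ltP v 0) => hv;
  rewrite ?subrr; try lra; case: (ltP 1 u) => hu1; case: (ltP 1 v) => hv1; lra.
Qed.

Lemma ramp_ge a d t : 0 < d -> ((t <= a)%R)%:R <= ramp a d t.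
Proof.
move=> d0; case: (leP t a) => ta /=; last by case/andP: (ramp01 a d t).
rewrite le_min lexx /= le_max; apply/orP; right.
by rewrite ler_pdivlMr //; lra.
Qed.

Lemma ramp_le a d t : 0 < d -> ramp a d t <= ((t <= a + d)%R)%:R.
Proof.
move=> d0; case: (leP t (a + d)) => ta /=; first by case/andP: (ramp01 a d t).
rewrite ge_min; apply/orP; right; rewrite ge_max lexx /=.
by rewrite ler_pdivrMr //; lra.
Qed.

Let int_gauss : mu.-integrable setT (EFin \o normal_pdf (0 : R) 1).
Proof. exact: integrable_normal_pdf. Qed.

Let normal_cdfE x : normal_cdf x = \int[mu]_t (((t <= x)%R)%:R * normal_pdf 0 1 t).
Proof.
rewrite /normal_cdf /normal_prob -[LHS]/(\int[mu]_(t in `]-oo, x]) normal_pdf 0 1 t).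
rewrite Rintegral_mkcond; apply: eq_Rintegral => t _.
rewrite patchE; case: ifPn => [|].
  by rewrite inE /= in_itv /= => ->; rewrite mul1r.
by rewrite notin_setE /= in_itv /= => /negP/negbTE ->; rewrite mul0r.
Qed.

Let int_ind x : mu.-integrable setT
  (EFin \o (fun t => ((t <= x)%R)%:R * normal_pdf (0 : R) 1 t)).
Proof.
apply: le_integrable int_gauss => //.
  apply/measurable_EFinP; apply: measurable_funM; last exact: measurable_normal_pdf.
  rewrite (_ : (fun t => _) = \1_`]-oo, x] :> (R -> R)); last first.
    apply/funext => t; rewrite indicE; congr (_%:R).
    by rewrite mem_setE in_itv.
  exact: measurable_indic.
move=> t _ /=; rewrite lee_fin normrM.
by case: (t <= x)%R; rewrite ?normr1 ?normr0 ?mul1r // mul0r.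
Qed.

Let int_ramp a d : 0 < d -> mu.-integrable setT
  (EFin \o (fun t => ramp a d t * normal_pdf (0 : R) 1 t)).
Proof.
move=> d0; apply: integrable_gauss_bounded.
  exact: lipschitz_continuous (ramp_lipschitz a d0).
by move=> x; have /andP[r0 r1] := ramp01 a d x; rewrite ger0_norm.
Qed.

Lemma normal_cdf_le_ramp a d : 0 < d -> normal_cdf a <= gauss_mean (ramp a d).
Proof.
move=> d0; rewrite normal_cdfE; apply: le_Rintegral => //; first exact: int_ramp.
by move=> t _; rewrite ler_wpM2r ?normal_pdf_ge0 // ramp_ge.
Qed.

Lemma ramp_le_normal_cdf a d : 0 < d -> gauss_mean (ramp a d) <= normal_cdf (a + d).
Proof.
move=> d0; rewrite normal_cdfE; apply: le_Rintegral => //; first exact: int_ramp.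
by move=> t _; rewrite ler_wpM2r ?normal_pdf_ge0 // ramp_le.
Qed.

End Ramp.

Section Main.
Variables (R : realType) (V : choiceType) (adj : rel V) (o : V) (p : R).
Variable P : probability (config adj) R.
Hypothesis sg : simple_graph adj.
Hypothesis inf : infinite_set [set: V].
Hypothesis conn : connected_graph adj.
Hypothesis lf : locally_finite adj.
Hypothesis qt : quasi_transitive adj.
Hypothesis p01 : 0 < p < 1.
Hypothesis bern : bernoulli_percolation P p.

Local Notation E r := (edges_in adj (Ball adj o r)).
Local Notation inc r := (@ends V adj (Ball adj o r)).
Local Notation K r := (cluster_sum (inc r) (kappa_all R)).

Let KcompE r : Kcomp R o r = fun w => K r (restrict_cfg (E r) w).
Proof. by apply/funext => w; exact: ncomponents_cluster_sum. Qed.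

Let standardizedE r (w : config adj) :
  standardized P (Kcomp R o r) w = standardize p (K r) (restrict_cfg (E r) w).
Proof.
rewrite /standardized KcompE (expectation_restrict bern).
by rewrite (variance_restrict bern).
Qed.

Let cdfE r (x : R) : cdf (standardized P (Kcomp R o r) : {RV P >-> R}) x =
  (Ex p (fun g => ((standardize p (K r) g <= x)%R)%:R))%:E.
Proof.
rewrite -(prob_restrict_le bern) /cdf /distribution /pushforward; congr (P _).
by apply/seteqP; split => w /=; rewrite in_itv /= standardizedE.
Qed.

(** The balls exhaust the infinite vertex set, and every vertex of a ball has a
    neighbour in it, so the number of edges of the balls tends to infinity. *)
Lemma clt_ball (h : R -> R) (L : R) :
  (forall x y, `|h y - h x| <= L * `|y - x|) ->
  (forall x, 0 <= h x <= 1) -> forall eps : R, 0 < eps ->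
  \forall r \near \oo,
    `|Ex p (fun g => h (standardize p (K r) g)) - gauss_mean h| <= eps.
Proof.
move=> hL h01 eps e0; have [D degD] := bounded_degree lf qt.
have [m0 clt] := clt_cluster_sum p01 D hL h01 e0.
have [r0 ball] := card_Ball_unbounded o conn lf inf (2 * m0).
exists (maxn 1 r0) => // r /=; rewrite geq_max => /andP[r1 r0r].
have TI : (#|{: Ball adj o r}| <= 2 * #|{: E r}|)%N.
  by apply: (card_vertices_le sg) => x; exact: Ball_neighbor.
have [||_ bound] := clt _ _ (inc r) (card_ends sg) _ TI.
- by move=> x; apply: (card_edges_at sg) => //; exact: lf.
- rewrite -(leq_pmul2l (isT : 0 < 2)%N); apply: leq_trans TI.
  by rewrite -cardfE; exact: ball.
- exact: bound.
Qed.

(** The indicator of a half-line lies between two ramps, whose Gaussian means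
    are close to the distribution function at [x] by continuity. *)
Lemma clt_Kcomp :
  cvg_in_distribution (fun r => standardized P (Kcomp R o r) : {RV P >-> R})
    (normal_prob 0 1).
Proof.
move=> x cx.
have normal_cdfE (y : R) : normal_prob 0 1 `]-oo, y] = (normal_cdf y)%:E.
  by rewrite fineK // fin_num_measure.
rewrite [X in _ --> X](_ : _ = (normal_cdf x)%:E); last exact: normal_cdfE.
under eq_fun do rewrite cdfE.
apply: cvg_EFin; first exact: nearW.
have cont_cdf : {for x, continuous (@normal_cdf R)}.
  by apply: fine_cvg; rewrite -normal_cdfE; exact: cx.
apply/cvgrPdist_le => eps e0.
have e2 : 0 < eps / 2 by rewrite divr_gt0.
have /cvgrPdist_le/(_ _ e2)/nbhs_ballP[d /= d0 ball] := cont_cdf.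
pose h := d / 2.
have h0 : 0 < h by rewrite divr_gt0.
have near_cdf y : `|x - y| <= h -> `|normal_cdf x - normal_cdf y| <= eps / 2.
  by move=> xy; apply: ball; apply: le_lt_trans xy _; rewrite /h; lra.
have up : `|normal_cdf x - normal_cdf (x + h)| <= eps / 2.
  by apply: near_cdf; rewrite opprD addrA subrr add0r normrN gtr0_norm.
have down : `|normal_cdf x - normal_cdf (x - h)| <= eps / 2.
  by apply: near_cdf; rewrite opprB addrC subrK gtr0_norm.
near=> r.
have upr : `|Ex p (fun g => ramp x h (standardize p (K r) g)) -
    gauss_mean (ramp x h)| <= eps / 2.
  near: r; exact: (clt_ball (ramp_lipschitz x h0) (ramp01 x h) e2).
have downr : `|Ex p (fun g => ramp (x - h) h (standardize p (K r) g)) -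
    gauss_mean (ramp (x - h) h)| <= eps / 2.
  near: r; exact: (clt_ball (ramp_lipschitz (x - h) h0) (ramp01 (x - h) h) e2).
set c := Ex p _ in upr; set c' := Ex p _ in downr.
rewrite /=; set q := Ex p _.
have qc : q <= c by apply: le_Ex => // g; exact: ramp_ge.
have qc' : c' <= q.
  by apply: le_Ex => // g; have := ramp_le (x - h) (standardize p (K r) g) h0; rewrite subrK.
have u1 := ramp_le_normal_cdf x h0.
have u2 := normal_cdf_le_ramp (x - h) h0.
move: up down upr downr; rewrite !ler_norml.
move=> /andP[? ?] /andP[? ?] /andP[? ?] /andP[? ?]; apply/andP; split; lra.
Unshelve. all: by end_near. Qed.

End Main.

Theorem theorem3p1 (R : realType) (V : choiceType) (adj : rel V) (o : V) (p : R)
    (P : probability (config adj) R) :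
  simple_graph adj ->
  infinite_set [set: V] ->
  connected_graph adj ->
  locally_finite adj ->
  quasi_transitive adj ->
  subexponential_growth adj R ->
  0 < p < 1 ->
  bernoulli_percolation P p ->
  cvg_in_distribution
    (fun r => standardized P (Kcomp R o r) : {RV P >-> R})
    (normal_prob 0 1).
Proof.
move=> sg inf conn lf qt _ p01 bern.
exact: (clt_Kcomp o sg inf conn lf qt p01 bern).
Qed.
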